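(* Let $K$ be a finite field of order $q$, let $\mathbf{F}$ be the free group on $r\ge1$ generators, and let $1\ne w\in\mathbf{F}$ be a non-power. Then the random variables $\mathrm{fix}_{w,N}$ converge in distribution as $N\to\infty$, and their limit distribution is identical to the limit distribution of $\mathrm{fix}_{a,N}$, where $a$ is a basis element of $\mathbf{F}$ (so that $\mathrm{fix}_{a,N}$ is the number of fixed vectors of a uniformly random element of $\mathrm{GL}_N(K)$). Explicitly, this limit is the probability measure $\nu$ supported on $\{q^k\mid k\in\mathbb{Z}_{\ge0}\}$ with $$\nu(\{q^k\})=\left(\prod_{i=1}^{\infty}(1-q^{-i})\right)\cdot\frac{q^{-k^2}}{\prod_{i=1}^{k}(1-q^{-i})^2}\qquad(k\ge0).$$
   Context: $\mathbf{F}$ has a fixed basis $b_1,\ldots,b_r$ and $w(g_1,\ldots,g_r)$ is the image of $w$ under the homomorphism $b_i\mapsto g_i$. $\mathrm{fix}_{w,N}$ is the random variable giving the number of vectors $v\in K^N$ (row vectors) with $v\cdot w(g_1,\ldots,g_r)=v$, where $g_1,\ldots,g_r$ are independent uniformly random elements of $\mathrm{GL}_N(K)$. A non-power is an element not of the form $v^k$ with $v\in\mathbf{F}$, $k\ge2$. *)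

(* Defs.v *)
From HB Require Import structures.
From mathcomp Require Import all_boot all_order all_fingroup all_algebra.
From mathcomp Require Import all_classical all_reals all_analysis.

Set Implicit Arguments.
Unset Strict Implicit.
Unset Printing Implicit Defensive.

Import Order.TTheory GRing.Theory Num.Theory.
Import numFieldNormedType.Exports.

Local Open Scope classical_set_scope.
Local Open Scope group_scope.

(* The free group of rank r, realized as the group of reduced words: the      *)
(* letter (i, false) stands for b_i and (i, true) for its inverse.            *)

Section FreeGroup.
Variable r : nat.

Definition letter : Type := ('I_r * bool)%type.
HB.instance Definition _ := Choice.on letter.

Definition inv_letter (x : letter) : letter := (x.1, ~~ x.2).

Definition reduced (s : seq letter) : bool :=
  sorted (fun x y => y != inv_letter x) s.

Definition free_group : Type := {s : seq letter | reduced s}.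
HB.instance Definition _ := SubType.on free_group.
HB.instance Definition _ := Choice.on free_group.

Definition push (x : letter) (s : seq letter) : seq letter :=
  if s is y :: t then if y == inv_letter x then t else x :: s else [:: x].

Definition mul_word (s t : seq letter) : seq letter := foldr push t s.

Definition inv_word (s : seq letter) : seq letter := rev (map inv_letter s).

Lemma inv_letterK : involutive inv_letter.
Proof. by case=> i e; rewrite /inv_letter /= negbK. Qed.

Lemma push_reduced x s : reduced s -> reduced (push x s).
Proof.
case: s => [//|y t] /= yt; case: ifP => [_|/negbT yx]; first exact: path_sorted yt.
by rewrite /reduced /= yx.
Qed.

Lemma push_cons x s : reduced (x :: s) -> push x s = x :: s.
Proof. by case: s => [//|y s] /= /andP[/negbTE ->]. Qed.

Lemma pushK x s : reduced s -> push (inv_letter x) (push x s) = s.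
Proof.
case: s => [|y t] rs /=; first by rewrite inv_letterK eqxx.
case: eqP => [yx|_] /=; first by rewrite -yx push_cons.
by rewrite inv_letterK eqxx.
Qed.

Lemma mul_word_reduced s t : reduced t -> reduced (mul_word s t).
Proof. by move=> rt; elim: s => //= x s IH; exact: push_reduced. Qed.

Lemma mul_word_push x s t :
  reduced t -> mul_word (push x s) t = push x (mul_word s t).
Proof.
move=> rt; case: s => [//|y s] /=; case: eqP => [->|//].
by have := pushK (inv_letter x) (mul_word_reduced s rt); rewrite inv_letterK => ->.
Qed.

Lemma mul_wordA s t u : reduced u ->
  mul_word s (mul_word t u) = mul_word (mul_word s t) u.
Proof. by move=> ru; elim: s => //= x s ->; rewrite mul_word_push. Qed.

Lemma mul_words0 s : reduced s -> mul_word s [::] = s.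
Proof.
elim: s => //= x s IH rxs; rewrite IH ?push_cons//; exact: path_sorted rxs.
Qed.

Lemma inv_wordK : involutive inv_word.
Proof. by move=> s; rewrite /inv_word map_rev revK mapK//; exact: inv_letterK. Qed.

Lemma inv_word_reduced s : reduced s -> reduced (inv_word s).
Proof.
rewrite /reduced /inv_word rev_sorted sorted_map.
by apply: sub_sorted => x y; apply: contra; rewrite /relpre inv_letterK eq_sym.
Qed.

Lemma mul_inv_word s : mul_word (inv_word s) s = [::].
Proof.
elim: s => // x s IH.
by rewrite /inv_word /= rev_cons -cats1 /mul_word foldr_cat /= inv_letterK eqxx.
Qed.

Definition free_one : free_group := exist _ [::] isT.
Definition free_mul (v w : free_group) : free_group :=
  exist _ (mul_word (val v) (val w)) (mul_word_reduced _ (valP w)).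
Definition free_inv (w : free_group) : free_group :=
  exist _ (inv_word (val w)) (inv_word_reduced (valP w)).

Fact free_mulA : associative free_mul.
Proof. by move=> u v w; apply/val_inj/mul_wordA/(valP w). Qed.
Fact free_mul1 : left_id free_one free_mul.
Proof. by move=> w; apply/val_inj. Qed.
Fact free_mulr1 : right_id free_one free_mul.
Proof. by move=> w; apply/val_inj/mul_words0/(valP w). Qed.
Fact free_mulV : left_inverse free_one free_inv free_mul.
Proof. by move=> w; apply/val_inj/mul_inv_word. Qed.
Fact free_mulrV : right_inverse free_one free_inv free_mul.
Proof.
by move=> w; apply/val_inj; rewrite /= -{1}[val w]inv_wordK mul_inv_word.
Qed.

HB.instance Definition _ := isGroup.Build free_group
  free_mulA free_mul1 free_mulr1 free_mulV free_mulrV.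

Definition free_gen (i : 'I_r) : free_group := exist _ [:: (i, false)] isT.

Section Eval.
Variables (G : groupType) (g : 'I_r -> G).

Definition letter_eval (x : letter) : G := if x.2 then (g x.1)^-1 else g x.1.

Definition word_eval (w : free_group) : G := \prod_(x <- val w) letter_eval x.

Lemma letter_evalV x : letter_eval (inv_letter x) = (letter_eval x)^-1.
Proof. by case: x => i [] /=; rewrite /letter_eval /= ?invgK. Qed.

Lemma prod_push x s : \prod_(y <- push x s) letter_eval y =
  letter_eval x * \prod_(y <- s) letter_eval y.
Proof.
case: s => [|y s] /=; first by rewrite big_seq1 big_nil mulg1.
case: eqP => [->|_]; last by rewrite big_cons.
by rewrite big_cons letter_evalV mulVKg.
Qed.

Fact word_eval_morphism : monoid.monoid_morphism word_eval.
Proof.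
split=> [|v w]; first by rewrite /word_eval big_nil.
rewrite /word_eval /=; elim: (val v) => [|x s IH] /=; first by rewrite big_nil mul1g.
by rewrite prod_push IH big_cons mulgA.
Qed.

HB.instance Definition _ :=
  isUMagmaMorphism.Build free_group G word_eval word_eval_morphism.

Lemma word_eval_gen i : word_eval (free_gen i) = g i.
Proof. by rewrite /word_eval big_seq1. Qed.

Lemma word_eval_unique (f : free_group -> G) : monoid.monoid_morphism f ->
  (forall i, f (free_gen i) = g i) -> f =1 word_eval.
Proof.
move=> [f1 fM] fg [s rs]; rewrite /word_eval /=.
elim: s rs => [|x s IH] rxs.
  by rewrite big_nil -f1; congr f; apply: val_inj.
have rs : reduced s := path_sorted rxs.
have fV i : f (free_gen i)^-1 = (g i)^-1.
  by apply: (mulgI (g i)); rewrite -{1}fg -fM !mulgV.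
have fx : f (exist _ [:: x] isT) = letter_eval x.
  case: x {rxs} => i []; rewrite /letter_eval /= -?fV -?fg;
  by congr f; apply: val_inj.
rewrite big_cons -(IH rs) -fx -fM; congr f; apply: val_inj => /=.
by rewrite push_cons.
Qed.

End Eval.

Definition nonpower (w : free_group) : Prop :=
  forall (v : free_group) (k : nat), (2 <= k)%N -> w <> v ^+ k.

(* B is a basis when the endomorphism b_i |-> B_i is bijective; all bases of  *)
(* the free group of rank r have r elements.                                  *)
Definition is_basis (B : 'I_r -> free_group) : Prop := bijective (word_eval B).

Definition basis_element (a : free_group) : Prop :=
  exists B : 'I_r -> free_group, is_basis B /\ exists i, a = B i.

End FreeGroup.

(* A finite group as a discrete probability space with its uniform measure,   *)
(* i.e. the normalized counting measure; the point 1 is irrelevant.           *)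

Definition discrete_group (G : finGroupType) : Type := G.

Section UniformGroup.
Variable G : finGroupType.

HB.instance Definition _ := Choice.on (discrete_group G).
HB.instance Definition _ := isPointed.Build (discrete_group G) (1 : G).
HB.instance Definition _ := @isMeasurable.Build default_measure_display
  (discrete_group G) discrete_measurable discrete_measurable0
  discrete_measurableC discrete_measurableU.

Variable R : realType.

Definition uniform_group : probability (discrete_group G) R :=
  mnormalize (@counting (discrete_group G) R) (dirac (1 : discrete_group G)).

End UniformGroup.

HB.instance Definition _ (I : finType) (G : finGroupType) :=
  Group.on {ffun I -> G}.

Local Open Scope ring_scope.

Section UniformGroupTheory.
Variables (G : finGroupType) (R : realType).

Lemma uniform_groupE (A : {set G}) :
  uniform_group G R [set x | x \in A] = (#|A|%:R / #|G|%:R)%:E.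
Proof.
have countE (B : {set G}) :
    @counting (discrete_group G) R [set x | x \in B] = (#|B|%:R)%:E.
  have finB : finite_set [set x : discrete_group G | x \in B].
    by apply: (@finite_finset (discrete_group G : finType)).
  rewrite /counting asboolT//; congr (_%:R%:E).
  rewrite cardE; apply/perm_size/uniq_perm; rewrite ?fset_uniq ?enum_uniq// => x.
  by rewrite mem_enum in_fset_set// mem_setE.
have GT : @counting (discrete_group G) R setT = (#|G|%:R)%:E.
  by rewrite -cardsT -countE; congr counting; apply/seteqP; split=> x //=; rewrite inE.
have G0 : #|G|%:R != 0 :> R by rewrite pnatr_eq0 -lt0n; apply/card_gt0P; exists 1%g.
by rewrite /uniform_group /= /mnormalize /= GT eqe (negbTE G0) /= countE -EFinM.
Qed.

End UniformGroupTheory.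

(* Under the uniform measure of G ^ r, the r coordinates are independent and  *)
(* uniformly distributed on G.                                                *)
Lemma uniform_group_iid (G : finGroupType) (R : realType) (r : nat)
    (A : 'I_r -> {set G}) :
  uniform_group {ffun 'I_r -> G} R
    [set g : {ffun 'I_r -> G} | forall i, g i \in A i] =
  (\prod_(i < r) (#|A i|%:R / #|G|%:R))%:E.
Proof.
have -> : [set g : {ffun 'I_r -> G} | forall i, g i \in A i] =
    [set g | g \in [set g in family A]].
  by apply/seteqP; split=> g /=; rewrite inE => /familyP.
rewrite uniform_groupE; congr (_%:E).
rewrite cardsE card_family card_ffun card_ord foldrE big_map big_enum /=.
by rewrite big_split /= natr_prod natrX prodfV prodr_const card_ord.
Qed.

(* 'rV_N.-1.+1 is the row space on which {'GL_N[K]} acts; for N = 0 the       *)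
(* library's general linear group is that of size 1.                          *)
Definition fixed_vectors (K : finFieldType) (N : nat) (g : {'GL_N[K]}) : nat :=
  #|[pred v : 'rV[K]_N.-1.+1 | v *m GLval g == v]|.

Section Fix.
Variables (R : realType) (K : finFieldType) (r N : nat).

Definition fix_uniform_fun (g : discrete_group {'GL_N[K]}) : R :=
  (fixed_vectors g)%:R.

HB.instance Definition _ := @isMeasurableFun.Build _ _
  (discrete_group {'GL_N[K]}) R fix_uniform_fun (fun _ _ _ => I).

Definition fix_uniform : {RV (uniform_group {'GL_N[K]} R) >-> R} :=
  fix_uniform_fun.

Definition fix_word_fun (w : free_group r)
    (g : discrete_group {ffun 'I_r -> {'GL_N[K]}}) : R :=
  (fixed_vectors (word_eval (g : {ffun 'I_r -> {'GL_N[K]}}) w))%:R.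

HB.instance Definition _ (w : free_group r) := @isMeasurableFun.Build _ _
  (discrete_group {ffun 'I_r -> {'GL_N[K]}}) R (fix_word_fun w)
  (fun _ _ _ => I).

Definition fix_word (w : free_group r) :
    {RV (uniform_group {ffun 'I_r -> {'GL_N[K]}} R) >-> R} :=
  fix_word_fun w.

End Fix.

Definition cvg_in_distribution (R : realType) (d : nat -> measure_display)
    (T : forall n, measurableType (d n)) (P : forall n, probability (T n) R)
    (X : forall n, {RV (P n) >-> R}) (nu : probability (measurableTypeR R) R) :
    Prop :=
  forall f : R -> R, continuous f -> (exists M : R, forall x, `|f x| <= M) ->
    ('E_(P n)[f \o X n] @[n --> \oo] --> \int[nu]_x (f x)%:E)%E.

(* Main.v *)
Require Import Defs.
From HB Require Import structures.
From mathcomp Require Import all_boot all_order all_fingroup all_algebra.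
From mathcomp Require Import zify ring lra.

(** Why the limit law does not depend on the word.  The number of vectors fixed
by w(g_1, ..., g_r) is q ^ D, where D is the dimension of the fixed space.  So
the law of this number is given by the masses p_N(k) = P(D = k), and the proof
finds their limits through frame counts.  Let an m-frame be a row-free m x N
matrix A.  The expected number of m-frames with A w(g) = A is the sum over k of
p_N(k) (q^k - 1) (q^k - q) ... (q^k - q^(m-1)).

For every m this expectation tends to 1 ([nonpower_moment_cvg]).  A conjugation
makes w = x_0 ... x_(l-1) cyclically reduced ([cyclic_reduction]).  A fixed frame
A then unfolds into a closed trajectory T_0 = A, T_(t+1) = T_t x_t(g), and the
expectation is the sum, over all l-tuples T of m x N matrices with T_0 row-free,
of the probability that g moves each T_t to T_(t+1).  The generator g_i has to
move in a prescribed way some of the T_t, which span a space of dimension d_i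
say.  This happens with probability at most about q^(- N d_i), while the number
of tuples T of rank d is at most a constant times q^(N d).  Hence T can matter
in the limit only if d_1 + ... + d_r <= d.  It turns out that then d = l m
([trajectory_rank]), and the tuples with d = l m contribute a ratio of numbers
of frames, which tends to 1.

The rank statement is a fact about matroids.  For a letter y, let star y be the
set of the positions on the cycle that y leaves or that the inverse of y enters.
As w is cyclically reduced, every position lies in exactly two stars.  Weights
that a greedy basis puts on the positions show that the ranks of the stars add
up to at least 2 d, and y moves its star isomorphically onto the star of its
inverse, so that d_1 + ... + d_r >= d.  If equality holds, then every star splits
off as a direct summand ([separator_star]).  Letters transport these splittings
([separator_move]).  Two positions which no splitting separates therefore read
the same cyclic word, in the same direction or in opposite directions.  The
former makes w a proper power ([atom_same]), the latter makes it a rotation of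
its own inverse, which is impossible for a cyclically reduced word
([atom_reverse]).  So all positions are separated, and d = l m.

The limits of the frame counts determine the limits of the masses, although the
ordinary moments grow too fast for the usual moment method.  Inverting the
counts writes p_N(k) as an alternating sum whose truncation error is at most the
first omitted term ([inversion_bonferroni]); in the limit the terms tend to 0, so
each p_N(k) converges ([mass_cvg]), and Euler's expansion of an infinite product
gives the limit in closed form ([limit_massE]).  The frame count for m = 1 makes
the laws tight.  Hence the limit masses add up to 1, and averages of bounded
functions converge ([average_cvg]).

Finally, substituting the elements of a basis of the free group permutes the
r-tuples of group elements, so a basis element takes uniformly distributed values
([basis_average]), exactly as a generator does; and a generator is a non-power
([free_gen_nonpower]), so the limit law is the same one. *)

Set Implicit Arguments.
Unset Strict Implicit.
Unset Printing Implicit Defensive.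

Import Order.TTheory GRing.Theory Num.Theory.
Local Open Scope ring_scope.

(** * Polymatroids carried by a reduced cycle *)

Section Polymatroid.
Variables (I : finType) (rk : {set I} -> nat).
Hypothesis rk0 : rk set0 = 0%N.
Hypothesis rkS : forall A B : {set I}, A \subset B -> (rk A <= rk B)%N.
Hypothesis rkUI :
  forall A B : {set I}, (rk (A :|: B) + rk (A :&: B) <= rk A + rk B)%N.

(** Modelled on the increments of the rank along an enumeration of [A], which generalize
the indicator function of a greedily chosen basis. *)
Definition greedy_weight (A : {set I}) (d : I -> nat) : Prop :=
  (forall S : {set I}, S \subset A -> (\sum_(t in S) d t <= rk S)%N) /\
  (\sum_(t in A) d t = rk A)%N.

(** The new point gets the weight [rk (e |: A) - rk A]; submodularity says that it
raises the rank of a subset of [A] by at least this amount. *)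
Lemma greedy_weight_add (A : {set I}) d e : greedy_weight A d -> e \notin A ->
  exists2 d', greedy_weight (e |: A) d' & {in A, d' =1 d}.
Proof.
move=> [dle dA] eA; pose d' t := if t == e then (rk (e |: A) - rk A)%N else d t.
have d'd : {in A, d' =1 d}.
  by move=> t tA; rewrite /d'; case: eqP eA tA => // -> /negbTE ->.
have rkeA : (rk A <= rk (e |: A))%N by apply/rkS/subsetUr.
have sumE (S : {set I}) : S \subset A ->
    (\sum_(t in e |: S) d' t = rk (e |: A) - rk A + \sum_(t in S) d t)%N.
  move=> SA; rewrite big_setU1 ?(contra (subsetP SA e))//= {1}/d' eqxx.
  by congr addn; apply: eq_bigr => t /(subsetP SA); exact: d'd.
exists d' => //; split=> [S SeA|]; last by rewrite sumE// dA subnK.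
have SA : S :\ e \subset A by rewrite subDset.
have [eS|eS] := boolP (e \in S); last first.
  have SA' : S \subset A.
    apply/subsetP => t tS; have /setU1P[te|//] := subsetP SeA t tS.
    by move: eS; rewrite -te tS.
  rewrite (eq_bigr d) ?dle// => t tS; exact/d'd/(subsetP SA').
rewrite -{1}(setD1K eS) sumE//.
have := rkUI S A; have -> : S :|: A = e |: A.
  apply/eqP; rewrite eqEsubset subUset SeA subsetUr/= subUset subsetUr andbT.
  by rewrite sub1set inE eS.
have -> : S :&: A = S :\ e.
  apply/setP => t; rewrite !inE andbC; have [tS|//] := boolP (t \in S); last by rewrite !andbF.
  case: eqP => [->|te]; first by rewrite (negbTE eA).
  by rewrite andbT; apply: (subsetP SA); rewrite !inE tS andbT; apply/eqP.
by have := dle _ SA; lia.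
Qed.

Lemma greedy_weight_extend (A B : {set I}) d : greedy_weight A d -> A \subset B ->
  exists2 d', greedy_weight B d' & {in A, d' =1 d}.
Proof.
move: {2}#|B :\: A| (erefl #|B :\: A|) => n.
elim: n A d => [|n IH] A d cBA dA sAB.
  have -> : B = A; last by exists d.
  by apply/eqP; rewrite eqEsubset sAB andbT -setD_eq0 -cards_eq0 cBA.
have /set0Pn[e] : B :\: A != set0 by rewrite -cards_eq0 cBA.
rewrite inE => /andP[eA eB].
have [d1 d1A d1d] := greedy_weight_add dA eA.
have [||d2 d2B d2d1] := IH (e |: A) d1 _ d1A.
- move: cBA; rewrite (cardsD1 e (B :\: A)) inE eA eB setDDl setUC add1n.
  by case.
- by rewrite subUset sub1set eB.
by exists d2 => // t tA; rewrite d2d1 ?d1d// inE tA orbT.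
Qed.

(** Enumerating the points of [C] first makes the weights sharp on [C] and on the
whole ground set at the same time. *)
Lemma greedy_weight_through (C : {set I}) :
  exists2 d, greedy_weight setT d & (\sum_(t in C) d t = rk C)%N.
Proof.
have d0 : greedy_weight set0 (fun=> 0%N).
  split=> [S|]; last by rewrite big_set0 rk0.
  by rewrite subset0 => /eqP->; rewrite big_set0.
have [d1 d1C _] := greedy_weight_extend d0 (sub0set C).
have [d2 d2T d21] := greedy_weight_extend d1C (subsetT C).
by exists d2 => //; rewrite (eq_bigr d1)//; case: d1C.
Qed.

(** The direct summands of the matroid.  The definition asks for the splitting of
every subset, which makes stability under intersection a computation; by
[separator_ge] it is enough to split the whole set. *)
Definition separator (S : {set I}) : bool :=
  [forall A : {set I}, rk A == (rk (A :&: S) + rk (A :\: S))%N].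

Lemma separatorP (S : {set I}) :
  reflect (forall A : {set I}, rk A = (rk (A :&: S) + rk (A :\: S))%N) (separator S).
Proof. by apply: (iffP forallP) => h A; apply/eqP. Qed.

(** Submodularity, applied to [A] and [S] and then to [A :|: S] and the complement of
[S], carries the splitting of the whole set over to [A]. *)
Lemma separator_ge (S : {set I}) : (rk S + rk (~: S) <= rk setT)%N -> separator S.
Proof.
move=> leS; apply/separatorP => A.
have := rkUI (A :&: S) (A :\: S); rewrite setID.
have -> : A :&: S :&: (A :\: S) = set0.
  by apply/setP => t; rewrite !inE; case: (t \in S); rewrite ?andbF.
have := rkUI A S; have := rkUI (A :|: S) (~: S).
have -> : A :|: S :|: ~: S = setT by rewrite -setUA setUCr setUT.
have -> : (A :|: S) :&: ~: S = A :\: S by rewrite setIUl setICr setU0 setDE.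
rewrite rk0; lia.
Qed.

Lemma separatorT : separator setT.
Proof. by apply/separatorP => A; rewrite setIT setDT rk0 addn0. Qed.

Lemma separatorC (S : {set I}) : separator S -> separator (~: S).
Proof.
by move=> /separatorP sS; apply/separatorP => A; rewrite -setDE [A :\: ~: S]setDE setCK addnC.
Qed.

Lemma separatorI (S U : {set I}) : separator S -> separator U -> separator (S :&: U).
Proof.
move=> /separatorP sS /separatorP sU; apply/separatorP => A.
rewrite (sS A) (sU (A :&: S)) (sS (A :\: (S :&: U))) -!addnA -setIA.
congr (_ + (rk _ + rk _))%N; apply/setP => t; rewrite !inE;
  by case: (t \in A); case: (t \in S); case: (t \in U).
Qed.

Definition atom t := \bigcap_(S : {set I} | separator S && (t \in S)) S.

Lemma separator_atom t : separator (atom t).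
Proof.
rewrite /atom; apply: (big_ind separator); first exact: separatorT.
  exact: separatorI.
by move=> S /andP[].
Qed.

(** As separators are stable under complement, a point of the smallest separator
around [t] cannot be told apart from [t] by any separator. *)
Lemma mem_atom t u : u \in atom t ->
  forall S : {set I}, separator S -> (t \in S) = (u \in S).
Proof.
move=> /bigcapP ut S sS; apply/idP/idP => [tS|]; first by apply: ut; rewrite sS.
apply: contraLR; rewrite -!in_setC => tS; apply: ut.
by rewrite separatorC.
Qed.

Lemma rk_separated : (forall t, separator [set t]) ->
  forall A : {set I}, rk A = (\sum_(t in A) rk [set t])%N.
Proof.
move=> sep1 A; move: {2}#|A| (erefl #|A|) => n; elim: n A => [|n IH] A cA.
  by move/eqP: cA; rewrite cards_eq0 => /eqP->; rewrite big_set0 rk0.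
have /set0Pn[t tA] : A != set0 by rewrite -cards_eq0 cA.
rewrite (separatorP _ (sep1 t) A) (big_setD1 t)//= -IH.
  by congr (rk _ + _)%N; apply/setIidPr; rewrite sub1set.
by move: cA; rewrite (cardsD1 t) tA add1n => -[].
Qed.

(** The positions [I] of a cyclic word: [o t] is the letter read when leaving [t]
forwards, [b t] the one read when leaving it backwards, and [sc] and [pr] are the
neighbours of [t].  That [o t] and [b t] differ says that the word is cyclically
reduced. *)
Section ReducedCycle.
Variables (L : finType) (inv : L -> L) (o b : I -> L) (sc pr : I -> I).
Hypotheses (invK : involutive inv) (inv_neq : forall y, inv y != y).
Hypotheses (scK : cancel sc pr) (prK : cancel pr sc).
Hypothesis b_sc : forall t, b (sc t) = inv (o t).
Hypothesis o_neq_b : forall t, o t != b t.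
Hypothesis sc_trans : forall t u, exists c, u = iter c sc t.
Hypothesis primitive :
  forall t u, (forall s, o (iter s sc t) = o (iter s sc u)) -> t = u.

(** The positions from which the letter [y] can be read, in either direction; reading
it leads to [move_along y]. *)
Definition star y : {set I} := [set t | (o t == y) || (b t == y)].
Definition move_along y t := if o t == y then sc t else pr t.

(* In the application [y] acts as a linear isomorphism between the spans of two stars. *)
Hypothesis rk_move : forall y (A : {set I}), A \subset star y ->
  rk (move_along y @: A) = rk A.

Lemma sum_star (d : I -> nat) :
  (\sum_y \sum_(t in star y) d t = 2 * \sum_t d t)%N.
Proof.
rewrite (exchange_big_dep xpredT)//= big_distrr/=; apply: eq_bigr => t _.
have -> : (2 = #|[set o t; b t]|)%N by rewrite cards2 o_neq_b.
rewrite -sum_nat_const; apply: eq_bigl => y.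
by rewrite !inE ![y == _]eq_sym.
Qed.

(** Take the weights that are sharp on the complement of one star [y0].  All the other
stars weigh at most their rank, and [star y0] weighs [rk setT - rk (~: star y0)],
which is short of its rank by the amount to which it fails to be a separator. *)
Lemma rk_star_excess y0 :
  (2 * rk setT + (rk (star y0) + rk (~: star y0)) <= \sum_y rk (star y) + rk setT)%N.
Proof.
have [d [dle dT] dC] := greedy_weight_through (~: star y0).
have sumT : (\sum_t d t = rk setT)%N.
  by rewrite -dT; apply: eq_bigl => t; rewrite inE.
have sum0 : (\sum_(t in star y0) d t + rk (~: star y0) = rk setT)%N.
  rewrite -sumT -dC [RHS](bigID (mem (star y0)))/=; congr addn.
  by apply: eq_bigl => t; rewrite inE.
have := sum_star d; rewrite sumT (bigD1 y0)//=.
rewrite [(\sum_y rk _)%N](bigD1 y0)//=.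
have : (\sum_(y | y != y0) \sum_(t in star y) d t <= \sum_(y | y != y0) rk (star y))%N.
  by apply: leq_sum => y _; apply: dle; exact: subsetT.
lia.
Qed.

Lemma o_pr t : o (pr t) = inv (b t).
Proof. by rewrite -{2}(prK t) b_sc invK. Qed.

Lemma move_star y t : t \in star y -> move_along y t \in star (inv y).
Proof.
rewrite !inE /move_along; case: eqP => [<- _|_ /= /eqP<-]; first by rewrite b_sc eqxx orbT.
by rewrite o_pr eqxx.
Qed.

Lemma move_alongK y t : t \in star y -> move_along (inv y) (move_along y t) = t.
Proof.
rewrite inE /move_along; have [<- _|oy /= /eqP<-] := eqVneq.
  by rewrite -b_sc (negbTE (o_neq_b _)).
by rewrite o_pr eqxx prK.
Qed.

Lemma move_along_subset y (A : {set I}) : A \subset star y ->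
  move_along y @: A \subset star (inv y).
Proof. by move=> /subsetP sA; apply/subsetP => _ /imsetP[t /sA ts ->]; exact: move_star. Qed.

Lemma move_along_star y : move_along y @: star y = star (inv y).
Proof.
apply/eqP; rewrite eqEsubset move_along_subset//=; apply/subsetP => t ty.
apply/imsetP; exists (move_along (inv y) t); last by have := move_alongK ty; rewrite invK.
by have := move_star ty; rewrite invK.
Qed.

Lemma card_star_inv y : #|star (inv y)| = #|star y|.
Proof.
rewrite -move_along_star card_in_imset// => t u ty uy.
by move=> /(congr1 (move_along (inv y))); rewrite !move_alongK.
Qed.

Lemma mem_move_along y (A : {set I}) t : A \subset star (inv y) -> t \in star y ->
  (t \in move_along (inv y) @: A) = (move_along y t \in A).
Proof.
move=> /subsetP sA ty; apply/imsetP/idP => [[u uA ->]|mA].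
  by have := move_alongK (sA _ uA); rewrite invK => ->.
by exists (move_along y t); rewrite ?move_alongK.
Qed.

(* The equality case, in which nothing is lost in [rk_star_excess]. *)
Hypothesis rk_star_le : (\sum_y rk (star y) <= 2 * rk setT)%N.

Lemma separator_star y : separator (star y).
Proof. by apply: separator_ge; have := rk_star_excess y; move: rk_star_le; lia. Qed.

(** Inside the separator [star (inv y)] the splitting of a set by the image of [U] is
the image of a splitting by [U], and moving along [y] preserves ranks. *)
Lemma separator_move y (U : {set I}) : U \subset star y -> separator U ->
  separator (move_along y @: U).
Proof.
move=> sU sepU; apply/separatorP => A.
have sMU := move_along_subset sU.
have sB : A :&: star (inv y) \subset star (inv y) by exact: subsetIr.
have sBB (S : {set I}) : A :&: star (inv y) :&: S \subset star (inv y).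
  exact: subset_trans (subsetIl _ _) sB.
have split1 : rk (A :&: star (inv y)) =
    (rk (A :&: move_along y @: U) + rk (A :&: star (inv y) :\: move_along y @: U))%N.
  rewrite -(rk_move sB) (separatorP _ sepU (_ @: _)).
  have mI (S : {set I}) (T : {set I}) : (forall t, t \in star y -> (t \in S) = (move_along y t \in T)) ->
      move_along (inv y) @: (A :&: star (inv y)) :&: S =
      move_along (inv y) @: (A :&: star (inv y) :&: T).
    move=> ST; apply/setP => t; rewrite inE.
    have [ty|tNy] := boolP (t \in star y).
      by rewrite !mem_move_along// ST// -in_setI.
    have notim (B : {set I}) : B \subset star (inv y) -> t \in move_along (inv y) @: B = false.
      move=> sB'; apply: contraNF tNy => tB.
      by have := subsetP (move_along_subset sB') _ tB; rewrite invK.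
    by rewrite !notim.
  have UE t : t \in star y -> (t \in U) = (move_along y t \in move_along y @: U).
    move=> ty; apply/idP/imsetP => [tU|[u uU]]; first by exists t.
    move=> /(congr1 (move_along (inv y))).
    by rewrite (move_alongK ty) (move_alongK (subsetP sU _ uU)) => ->.
  rewrite (mI U (move_along y @: U))// [_ :\: U]setDE (mI (~: U) (~: (move_along y @: U))); last first.
    by move=> t ty; rewrite !in_setC UE.
  by rewrite !rk_move// -setIA (setIidPr sMU) -setDE.
rewrite (separatorP _ (separator_star (inv y)) A) split1.
rewrite (separatorP _ (separator_star (inv y)) (A :\: move_along y @: U)) addnA.
congr (_ + rk _ + rk _)%N; apply/setP => t; rewrite !inE.
  by case: (t \in A); rewrite ?andbF ?andbT// andbC.
case tU: (t \in move_along y @: U) => /=; rewrite ?andbF//.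
by have := subsetP sMU _ tU; rewrite inE => ->; rewrite ?andbF.
Qed.

(** Pull a separator back along [y]: what does not separate [t] from [u] does not
separate their images either. *)
Lemma atom_move y t u : u \in atom t -> t \in star y ->
  move_along y u \in atom (move_along y t).
Proof.
move=> ut ty; have uy : u \in star y by rewrite -(mem_atom ut)// separator_star.
apply/bigcapP => S /andP[sepS tS].
have sub : S :&: star (inv y) \subset star (inv y) by exact: subsetIr.
have := separator_move sub (separatorI sepS (separator_star _)).
move=> /(mem_atom ut); rewrite !mem_move_along// !in_setI tS move_star//=.
by move=> /esym /andP[].
Qed.

(** The two positions are entered through the same letter and lie in the same stars,
so they are also left through the same letter. *)
Lemma atom_step t u : u \in atom t -> o u = o t ->
  sc u \in atom (sc t) /\ o (sc u) = o (sc t).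
Proof.
move=> ut out; have scut : sc u \in atom (sc t).
  have := @atom_move (o t) t u ut; rewrite inE /move_along out !eqxx; exact.
split=> //; have := mem_atom scut (separator_star (o (sc t))).
rewrite !inE eqxx /= => /esym /orP[/eqP//|].
by rewrite b_sc out -b_sc eq_sym (negbTE (o_neq_b _)).
Qed.

Lemma atom_step_back t u : u \in atom t -> b u = o t ->
  pr u \in atom (sc t) /\ b (pr u) = o (sc t).
Proof.
move=> ut but; have ou : o u != o t by rewrite -but o_neq_b.
have prut : pr u \in atom (sc t).
  have := @atom_move (o t) t u ut; rewrite inE /move_along eqxx (negbTE ou); exact.
split=> //; have := mem_atom prut (separator_star (o (sc t))).
rewrite !inE eqxx /= => /esym /orP[|/eqP//].
by rewrite o_pr but -b_sc eq_sym (negbTE (o_neq_b _)).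
Qed.

Lemma atom_same t u : u \in atom t -> o u = o t -> t = u.
Proof.
move=> ut out; apply: primitive => s.
suff [] : iter s sc u \in atom (iter s sc t) /\ o (iter s sc u) = o (iter s sc t) by [].
by elim: s => //= s [ius os]; exact: atom_step.
Qed.

(** Walking forwards from [t] and backwards from [u] reads the same letters, so the two
walks meet at a position with [o t = b t], or face each other across an edge whose
letter equals its own inverse. *)
Lemma atom_reverse t u : u \in atom t -> b u = o t -> False.
Proof.
move=> ut but.
have back s : iter s pr u \in atom (iter s sc t) /\ b (iter s pr u) = o (iter s sc t).
  by elim: s => //= s [ius os]; exact: atom_step_back.
have prKn s v : iter s pr (iter s sc v) = v.
  by elim: s v => // s IH v; rewrite iterSr iterS scK IH.
(* After half of the distance from [t] to [u] the walks meet or are adjacent. *)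
have [c uE] := sc_trans t u; rewrite -(odd_double_half c) -addnn in uE.
have [_] := back c./2; move: uE; case: (odd c) => /= ->; rewrite add0n.
  by rewrite -iterS -addnS iterD prKn /= b_sc => /eqP; rewrite (negbTE (inv_neq _)).
by rewrite iterD prKn => /eqP; rewrite eq_sym (negbTE (o_neq_b _)).
Qed.

Lemma atom1 t : atom t = [set t].
Proof.
apply/setP => u; rewrite in_set1; apply/idP/eqP => [ut|->]; last first.
  by apply/bigcapP => S /andP[].
have := mem_atom ut (separator_star (o t)); rewrite !inE eqxx /= => /esym /orP[/eqP|/eqP].
  by move=> /(atom_same ut).
by move=> /(atom_reverse ut).
Qed.

(** Singletons are separators, so the rank is the sum of the ranks of the positions,
and these are all equal because letters move them to each other. *)
Lemma rk_reduced_cycle t0 : rk setT = (#|I| * rk [set t0])%N.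
Proof.
rewrite rk_separated; last by move=> t; rewrite -atom1 separator_atom.
rewrite (eq_bigr (fun=> rk [set t0])) => [|t _].
  by rewrite sum_nat_const cardsT.
have [c ->] := sc_trans t0 t; elim: c => //= c <-.
move: (iter c sc t0) => u; rewrite -(@rk_move (o u) [set u]).
  by rewrite imset_set1 /move_along eqxx.
by rewrite sub1set inE eqxx.
Qed.

End ReducedCycle.
End Polymatroid.

(** * Ranks of families of matrices and counting in the general linear group *)

Section SpanRank.
Variables (K : fieldType) (I : finType) (m n : nat).
Implicit Types (T : I -> 'M[K]_(m, n)) (S : {set I}).

Definition row_span T S : 'M[K]_n := (\sum_(t in S) <<T t>>)%MS.
Definition span_rank T S : nat := \rank (row_span T S).

Lemma row_span_subP T S p (W : 'M[K]_(p, n)) :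
  reflect (forall t, t \in S -> (T t <= W)%MS) (row_span T S <= W)%MS.
Proof.
by apply: (iffP sumsmx_subP) => h t /h; rewrite genmxE.
Qed.

Lemma row_span_sup T S t : t \in S -> (T t <= row_span T S)%MS.
Proof. by move=> tS; apply: (sumsmx_sup t); rewrite ?genmxE. Qed.

Lemma span_rank0 T : span_rank T set0 = 0%N.
Proof. by rewrite /span_rank /row_span big_set0 mxrank0. Qed.

Lemma span_rankS T (A B : {set I}) : A \subset B -> (span_rank T A <= span_rank T B)%N.
Proof.
by move=> /subsetP sAB; apply/mxrankS/row_span_subP => t /sAB; exact: row_span_sup.
Qed.

(** The span of an intersection lies in the intersection of the spans, so the dimension
formula becomes an inequality. *)
Lemma span_rankUI T (A B : {set I}) :
  (span_rank T (A :|: B) + span_rank T (A :&: B) <= span_rank T A + span_rank T B)%N.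
Proof.
rewrite /span_rank -[leqRHS]mxrank_sum_cap leq_add//; apply/mxrankS.
  apply/row_span_subP => t /setUP[tA|tB].
    exact: submx_trans (row_span_sup T tA) (addsmxSl _ _).
  exact: submx_trans (row_span_sup T tB) (addsmxSr _ _).
by apply/row_span_subP => t /setIP[tA tB]; rewrite sub_capmx !row_span_sup.
Qed.

Lemma span_rank1 T t : span_rank T [set t] = \rank (T t).
Proof. by rewrite /span_rank /row_span big_set1 mxrank_gen. Qed.

Lemma span_rank_move T (f : I -> I) (g : 'M[K]_n) S : g \in unitmx ->
  (forall t, t \in S -> T t *m g = T (f t)) ->
  span_rank T (f @: S) = span_rank T S.
Proof.
move=> gU Tf; rewrite /span_rank -[RHS](mxrankMfree (row_span T S) (B := g)) ?row_free_unit//.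
apply/eqP; rewrite eqn_leq !mxrankS//.
  rewrite -(mulmxK gU (row_span T S *m g)) -mulmxA mulmxV// mulmx1.
  rewrite (sumsmxMr _ _ _); apply/sumsmx_subP => t tS.
  by rewrite (eqmxMr _ (genmxE _)) Tf// row_span_sup// imset_f.
apply/row_span_subP => _ /imsetP[t tS ->]; rewrite -Tf//.
exact/submxMr/row_span_sup.
Qed.

Lemma mxcol_subP p (B : 'I_p -> 'M[K]_(m, n)) k (W : 'M[K]_(k, n)) :
  reflect (forall i, (B i <= W)%MS) (\mxcol_i B i <= W)%MS.
Proof.
apply: (iffP idP) => h.
  move=> i; move: h; rewrite !submxE mxcol_mul => /eqP /(congr1 (fun M => submxcol M i)).
  by rewrite mxcolK submxcol0 => ->.
rewrite submxE mxcol_mul; apply/eqP/mxcolP => i; rewrite mxcolK submxcol0.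
by apply/eqP; rewrite -submxE.
Qed.

Definition stack T S := \mxcol_(k < #|S|) T (enum_val k).

Lemma stack_rank T S : \rank (stack T S) = span_rank T S.
Proof.
apply/eqP; rewrite eqn_leq !mxrankS//.
  apply/row_span_subP => t tS; rewrite -(enum_rankK_in tS tS).
  exact: (elimT (mxcol_subP (fun k => T (enum_val k)) _) (submx_refl (stack T S))).
by apply/mxcol_subP => k; exact/row_span_sup/enum_valP.
Qed.

End SpanRank.

Section RowFreeCount.
Variable K : finFieldType.

Definition row_free_count (d n : nat) : nat := #|[set A : 'M[K]_(d, n) | row_free A]|.

Lemma card_submx d n (A : 'M[K]_(d, n)) :
  #|[set v : 'rV[K]_n | (v <= A)%MS]| = (#|K| ^ \rank A)%N.
Proof.
rewrite -[X in (_ ^ X)%N]mul1n -card_mx -cardsT.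
rewrite -(card_imset _ (row_free_inj (row_base_free A))); congr #|pred_of_set _|.
apply/setP => v; rewrite inE -(eq_row_base A); apply/idP/imsetP => [/submxP[u ->]|[u _ ->]].
  by exists u; rewrite ?inE.
exact: submxMl.
Qed.

Lemma row_free_col_mx d n (v : 'rV[K]_n) (A : 'M[K]_(d, n)) :
  row_free (col_mx v A) = row_free A && ~~ (v <= A)%MS.
Proof.
have rk1 : (\rank v <= 1)%N by apply: rank_leq_row.
have := mxrank_sum_cap v A; rewrite /row_free (eqmx_rank (introT eqmxP (addsmxE v A))).
have rkA := rank_leq_row A.
have [vA|vA] := boolP (v <= A)%MS.
  have sub : (col_mx v A <= A)%MS by rewrite -addsmxE addsmx_sub vA submx_refl.
  by move=> _; rewrite andbF; apply/negbTE/eqP => h2; have := mxrankS sub; rewrite h2; lia.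
have v0 : v != 0 by apply: contraNneq vA => ->; rewrite sub0mx.
have rv : \rank v = 1%N by rewrite rank_rV v0.
have -> : \rank (v :&: A) = 0%N.
  apply/eqP; rewrite mxrank_eq0; apply: contraNT vA => c0.
  have : \rank (v :&: A) == \rank v.
    have := mxrankS (capmxSl v A); rewrite rv; move: c0; rewrite -mxrank_eq0.
    by case: (\rank _) => [//|[//|?]]; lia.
  by rewrite (mxrank_leqif_sup (capmxSl v A)).2 sub_capmx => /andP[].
rewrite rv; move: (\rank _) (\rank _) => a b; rewrite andbT => h; apply/eqP/eqP; lia.
Qed.

(** The rows are chosen from the last one upwards: each new row has to avoid the span
of the previous ones. *)
Lemma row_free_countE d n : row_free_count d n = \prod_(a < d) (#|K| ^ n - #|K| ^ a)%N.
Proof.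
elim: d => [|d IH].
  rewrite big_ord0 /row_free_count (_ : [set A | _] = [set: 'M_(0, n)]).
    by rewrite cardsT card_mx mul0n.
  by apply/setP => A; rewrite !inE /row_free flatmx0 mxrank0.
rewrite big_ord_recr/= -IH.
transitivity (row_free_count d n * (#|K| ^ n - #|K| ^ d))%N; last by [].
rewrite /row_free_count -sum1_card.
pose h (p : 'rV[K]_n * 'M[K]_(d, n)) : 'M[K]_(1 + d, n) := col_mx p.1 p.2.
have hbij : bijective h.
  exists (fun A => (usubmx A, dsubmx A)) => [[v A]|A]; rewrite /h /=.
    by rewrite col_mxKu col_mxKd.
  by rewrite vsubmxK.
rewrite (reindex h) /=; last exact: onW_bij.
rewrite (eq_bigl (fun p => (p.2 \in [set A : 'M[K]_(d, n) | row_free A]) &&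
    ~~ (p.1 <= p.2)%MS)); last by move=> [v A]; rewrite !inE row_free_col_mx.
rewrite -(pair_big_dep xpredT (fun v A => (A \in [set A : 'M[K]_(d, n) | row_free A]) &&
   ~~ (v <= A)%MS) (fun _ _ => 1%N))/=.
rewrite (exchange_big_dep (fun A => A \in [set A : 'M[K]_(d, n) | row_free A]))/=; last first.
  by move=> v A _ /andP[].
rewrite -sum_nat_const; apply: eq_bigr => A; rewrite inE => fA.
rewrite fA /= sum1_card.
have -> : (#|K| ^ d)%N = #|[set v : 'rV[K]_n | (v <= A)%MS]|.
  by rewrite card_submx (eqP fA).
rewrite -[X in (#|K| ^ X)%N]mul1n -card_mx -cardsT -cardsDS ?subsetT// setTD -cardsE.
by apply: eq_card => v; rewrite !inE.
Qed.

(** The matrix [pinvmx A *m B] moves [A] to [B]; it has the right rank on the rows of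
[A], so it can be replaced by an invertible matrix with the same values there. *)
Lemma GL_transitive n d (A B : 'M[K]_(d, n.+1)) : row_free A -> row_free B ->
  exists g : {'GL_n.+1[K]}, A *m GLval g = B.
Proof.
move=> fA fB; have AB : A *m (pinvmx A *m B) = B by rewrite mulmxA mulmxVp// mul1mx.
have [|f fU fE] := @complete_unitmx _ _ _ A (pinvmx A *m B).
  by rewrite AB (eqP fA) (eqP fB).
by exists (FinRing.unit _ (fU : f \is a GRing.unit)); rewrite /= -fE AB.
Qed.

Lemma GLval_unitmx n (g : {'GL_n.+1[K]}) : GLval g \in unitmx.
Proof. exact: GL_unitmx. Qed.

Lemma GLvalM n (g h : {'GL_n.+1[K]}) : GLval (g * h)%g = GLval g *m GLval h.
Proof. by []. Qed.

(** Right translation by an element that moves [B] to [C] shows that all the targets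
[C] are hit equally often. *)
Lemma card_GL_moving n d (A B : 'M[K]_(d, n.+1)) : row_free A -> row_free B ->
  (#|[set g : {'GL_n.+1[K]} | A *m GLval g == B]| * row_free_count d n.+1 =
   #|{: {'GL_n.+1[K]}}|)%N.
Proof.
move=> fA fB.
have cE C : row_free C -> #|[set g : {'GL_n.+1[K]} | A *m GLval g == C]| =
    #|[set g : {'GL_n.+1[K]} | A *m GLval g == B]|.
  move=> fC; have [h hE] := GL_transitive fB fC.
  rewrite -(card_imset [set g : {'GL_n.+1[K]} | A *m GLval g == B] (@mulIg _ h)).
  congr #|pred_of_set _|; apply/setP => g; rewrite inE.
  apply/eqP/imsetP => [gE|[k + ->]].
    exists (g * h^-1)%g; rewrite ?mulgKV// inE GLvalM mulmxA gE -hE -mulmxA.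
    by rewrite -GLvalM mulgV mulmx1.
  by rewrite inE => /eqP kE; rewrite GLvalM mulmxA kE.
have AG (g : {'GL_n.+1[K]}) : row_free (A *m GLval g).
  by rewrite /row_free mxrankMfree ?row_free_unit ?GLval_unitmx.
rewrite -cardsT -[RHS]sum1_card.
rewrite (partition_big (fun g : {'GL_n.+1[K]} => A *m GLval g)
  (mem [set C : 'M[K]_(d, n.+1) | row_free C]))/=; last by move=> g _; rewrite inE.
rewrite mulnC -sum_nat_const; apply: eq_bigr => C; rewrite inE => fC.
by rewrite -(cE C fC) -sum1_card; apply: eq_bigl => g; rewrite !inE.
Qed.

Section Family.
Variables (I : finType) (m n : nat).
Implicit Types (T : I -> 'M[K]_(m, n.+1)) (S : {set I}).

Definition movers T T' S : {set {'GL_n.+1[K]}} :=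
  [set g : {'GL_n.+1[K]} | [forall t in S, T t *m GLval g == T' t]].

Lemma moversP T T' S (g : {'GL_n.+1[K]}) :
  reflect (forall t, t \in S -> T t *m GLval g = T' t) (g \in movers T T' S).
Proof.
by rewrite inE; apply: (iffP forall_inP) => h t tS; apply/eqP/h.
Qed.

(** All the movers agree on the span of the family, hence on a basis of it. *)
Lemma card_movers_le T T' S :
  (#|movers T T' S| * row_free_count (span_rank T S) n.+1 <= #|{: {'GL_n.+1[K]}}|)%N.
Proof.
have [->|/set0Pn[g0 g0P]] := eqVneq (movers T T' S) set0; first by rewrite cards0.
pose B := row_base (row_span T S).
have fB : row_free B by apply: row_base_free.
have fBg : row_free (B *m GLval g0).
  by rewrite /row_free mxrankMfree ?row_free_unit ?GLval_unitmx.
rewrite -(card_GL_moving fB fBg) leq_mul2r; apply/orP; right; apply: subset_leq_card.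
apply/subsetP => g gP; rewrite inE; apply/eqP.
have gg : row_span T S *m (GLval g - GLval g0) = 0.
  apply/eqP; rewrite -submx0 (sumsmxMr _ _ _); apply/sumsmx_subP => t tS.
  rewrite (eqmxMr _ (genmxE _)) mulmxBr (moversP _ _ _ _ gP)// (moversP _ _ _ _ g0P)//.
  by rewrite subrr sub0mx.
apply/eqP; rewrite -subr_eq0 -mulmxBr -submx0 (eqmxMr _ (eq_row_base _)).
by rewrite gg sub0mx.
Qed.

Lemma card_movers T T' S :
  span_rank T S = (\sum_(k < #|S|) m)%N -> span_rank T' S = (\sum_(k < #|S|) m)%N ->
  (#|movers T T' S| * row_free_count (\sum_(k < #|S|) m) n.+1 = #|{: {'GL_n.+1[K]}}|)%N.
Proof.
rewrite -!stack_rank => /eqP fT /eqP fT'; rewrite -(card_GL_moving fT fT').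
congr muln; apply: eq_card => g; rewrite [RHS]inE; apply/moversP/eqP => [h|].
  by rewrite mxcol_mul; apply/eq_mxcolP => k; apply/h/enum_valP.
rewrite mxcol_mul => /(iffRL (eq_mxcolP _ (fun k => T' (enum_val k)))) h t tS.
by have := h (enum_rank_in tS t); rewrite enum_rankK_in.
Qed.

(** A family of rank [d] is made of the products of coefficient matrices with one
common matrix of [d] rows. *)
Lemma card_span_rank d :
  (#|[set T : {ffun I -> 'M[K]_(m, n.+1)} | span_rank T setT == d]| <=
   #|K| ^ (d * n.+1) * (#|K| ^ (m * d)) ^ #|I|)%N.
Proof.
rewrite -!card_mx -card_ffun -card_prod.
pose h (p : 'M[K]_(d, n.+1) * {ffun I -> 'M[K]_(m, d)}) : {ffun I -> 'M[K]_(m, n.+1)} :=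
  [ffun t => p.2 t *m p.1].
apply: leq_trans (leq_imset_card h _); apply/subset_leq_card/subsetP => T.
rewrite inE => /eqP rT.
have : exists B : 'M[K]_(\rank (row_span T setT), n.+1), (row_span T setT <= B)%MS.
  by exists (row_base (row_span T setT)); rewrite eq_row_base.
rewrite -/(span_rank T setT) rT => -[B sB].
apply/imsetP; exists (B, [ffun t => T t *m pinvmx B]); rewrite ?inE//.
apply/ffunP => t; rewrite !ffunE /= mulmxKpV//.
by apply: submx_trans sB; apply: row_span_sup.
Qed.

End Family.
End RowFreeCount.

(** * Cyclically reduced words *)

Section CommutingWords.
Variable T : eqType.
Implicit Types p q z : seq T.

Lemma flatten_nseqD a b z : flatten (nseq a z) ++ flatten (nseq b z) = flatten (nseq (a + b) z).
Proof. by rewrite nseqD flatten_cat. Qed.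

(** Euclid's algorithm: the shorter of two commuting words is a prefix of the longer
one, and what remains of the latter still commutes with the former. *)
Lemma commuting_words p q : p ++ q = q ++ p ->
  exists z a b, p = flatten (nseq a z) /\ q = flatten (nseq b z).
Proof.
move: {2}(size p + size q)%N (leqnn (size p + size q)) => n.
elim: n p q => [|n IH] p q spq comm.
  exists [::], 0%N, 0%N; move: spq; rewrite leqn0 addn_eq0 !size_eq0.
  by move=> /andP[/eqP-> /eqP->].
have [p0|pn0] := eqVneq p [::].
  by exists q, 0%N, 1%N; rewrite p0 /= cats0.
have [q0|qn0] := eqVneq q [::].
  by exists p, 1%N, 0%N; rewrite q0 /= cats0.
wlog le_pq : p q spq comm pn0 qn0 / (size p <= size q)%N.
  move=> h; have [/h|/ltnW/h] := leqP (size p) (size q); first exact.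
  rewrite addnC => /(_ spq (esym comm) qn0 pn0) [z [a [b [-> ->]]]].
  by exists z, b, a.
have qE : q = p ++ drop (size p) q.
  rewrite -{1}(cat_take_drop (size p) q); congr (_ ++ _).
  by have := congr1 (take (size p)) comm; rewrite take_size_cat// takel_cat.
have comm' : p ++ drop (size p) q = drop (size p) q ++ p.
  move: comm; rewrite {1 2}qE -catA => /eqP; rewrite eqseq_cat// eqxx /= => /eqP.
  by [].
have [|z [a [b [pE q'E]]]] := IH _ _ _ comm'.
  have : (0 < size p)%N by rewrite lt0n size_eq0.
  by rewrite size_drop; move: spq; lia.
by exists z, a, (a + b)%N; split=> //; rewrite qE -flatten_nseqD -pE -q'E.
Qed.
End CommutingWords.

Section Words.
Variable r : nat.
Implicit Types w v : free_group r.

Lemma word_eval_free_gen w : word_eval (@free_gen r) w = w.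
Proof. by rewrite -(@word_eval_unique _ _ (@free_gen r) id). Qed.

(** Presenting an element as a product makes it possible to compute in the group
without keeping track of reductions. *)
Lemma free_groupE w : w = (\prod_(x <- val w) letter_eval (@free_gen r) x)%g.
Proof. by rewrite -[LHS]word_eval_free_gen. Qed.

Lemma nonpower_word w k z : nonpower w -> (2 <= k)%N ->
  val w <> flatten (nseq k z).
Proof.
move=> wn k2 wE.
apply: (wn (\prod_(x <- z) letter_eval (@free_gen r) x)%g k k2).
rewrite [LHS]free_groupE wE {k2 wE}.
elim: k => [|k IH] /=; first by rewrite big_nil expg0.
by rewrite big_cat IH expgS.
Qed.

Lemma inv_letter_neq (x : letter r) : inv_letter x != x.
Proof. by case: x => i []; apply/eqP => -[]. Qed.

Definition cyclically_reduced (s : seq (letter r)) : bool :=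
  path.cycle (fun x y => y != inv_letter x) s.

Lemma cyclically_reduced_nth x0 (s : seq (letter r)) t :
  cyclically_reduced s -> (t < size s)%N ->
  nth x0 s (t.+1 %% size s) != inv_letter (nth x0 s t).
Proof.
case: s => [//|x s] cs lt_t; have /(pathP x0)/(_ t) := cs.
rewrite size_rcons => /(_ lt_t); rewrite -rcons_cons !nth_rcons /= lt_t.
move: lt_t; rewrite ltnS leq_eqVlt => /orP[/eqP->|lt_t].
  by rewrite ltnn eqxx modnn.
by rewrite lt_t modn_small.
Qed.

(** If the first and the last letter cancel cyclically, conjugation removes both. *)
Lemma cyclic_reduction w : w <> 1%g ->
  exists u v : free_group r,
    [/\ w = (u * v * u^-1)%g, cyclically_reduced (val v) & (0 < size (val v))%N].
Proof.
move: {2}(size (val w)) (leqnn (size (val w))) => n.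
elim: n w => [|n IH] [s rs] /= sn w1.
  by case: w1; apply: val_inj; move: sn; rewrite leqn0 size_eq0 => /eqP.
have [cs|ncs] := boolP (cyclically_reduced s).
  exists 1%g, (exist _ s rs); split=> //; first by rewrite mul1g invg1 mulg1.
  by rewrite /= lt0n size_eq0; apply: contra_notN w1 => /eqP s0; apply: val_inj.
case: s rs sn w1 ncs => [|x s] rs sn w1; first by [].
have pxs : path (fun x y => y != inv_letter x) x s := rs.
rewrite /cyclically_reduced /= rcons_path pxs /=.
case/lastP: s rs sn w1 {pxs} => [|s z] rs sn w1 /=.
  by rewrite eq_sym (negbTE (inv_letter_neq x)).
rewrite last_rcons negbK => /eqP xE.
have rs' : reduced s.
  by have := rs; rewrite /reduced /= rcons_path => /andP[/path_sorted].
have zE : letter_eval (@free_gen r) z = (letter_eval (@free_gen r) x)^-1%g.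
  by rewrite -letter_evalV xE inv_letterK.
have [||u [v [sE cv v0]]] := IH (exist _ s rs') _ _.
- by move: sn; rewrite /= size_rcons; lia.
- move=> /(congr1 val) /= s0; have := rs; rewrite s0 /reduced /= xE inv_letterK eqxx.
  by [].
exists (letter_eval (@free_gen r) x * u)%g, v; split=> //.
rewrite [LHS]free_groupE /= big_cons -cats1 big_cat big_seq1 zE.
have -> : (\prod_(y <- s) letter_eval (@free_gen r) y)%g = exist _ s rs' :> free_group r.
  by rewrite [RHS]free_groupE.
by rewrite sE invMg !mulgA.
Qed.

Lemma nonpower_conj w u v : w = (u * v * u^-1)%g -> nonpower w -> nonpower v.
Proof.
move=> wE nw z k k2 vE; apply: (nw (u * z * u^-1)%g k k2).
rewrite wE vE => {vE k2}; elim: k => [|k IH]; first by rewrite !expg0 mulg1 mulgV.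
by rewrite !expgS -IH !mulgA mulgKV.
Qed.
End Words.

Section CyclicWord.
Variables (r : nat) (s : seq (letter r)).
Local Notation l := (size s).

Definition out_letter (t : 'I_l) : ('I_r * bool)%type := tnth (in_tuple s) t.
Definition back_letter (t : 'I_l) : ('I_r * bool)%type :=
  inv_letter (out_letter (ord_pred t)).

Lemma back_letter_ordS t : back_letter (ordS t) = inv_letter (out_letter t).
Proof. by rewrite /back_letter ordSK. Qed.

Lemma val_iter_ordS k (t : 'I_l) : iter k (@ordS l) t = ((t + k) %% l)%N :> nat.
Proof.
elim: k => [|k IH] /=; first by rewrite addn0 modn_small.
by rewrite IH -addn1 modnDml -addnA addn1.
Qed.

Lemma iter_ordS_trans (t u : 'I_l) : exists c, u = iter c (@ordS l) t.
Proof.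
exists (u + (l - t))%N; apply: val_inj; rewrite /= val_iter_ordS.
by rewrite addnCA subnKC ?modnDr ?modn_small// ltnW.
Qed.

Section Primitive.
Hypothesis s_prim : forall k z, (2 <= k)%N -> s <> flatten (nseq k z).

(** A word that equals one of its rotations is the concatenation of two commuting
words, hence a power. *)
Lemma rot_neq d : (0 < d < l)%N -> rot d s <> s.
Proof.
move=> /andP[d0 dl] rs.
have : take d s ++ drop d s = drop d s ++ take d s by rewrite cat_take_drop.
move=> /commuting_words [z [a [b [ta tb]]]].
have sE : s = flatten (nseq (a + b) z) by rewrite -flatten_nseqD -ta -tb cat_take_drop.
apply: (s_prim _ sE).
have a0 : (0 < a)%N.
  by case: a ta {sE} => // /(congr1 size) /eqP; rewrite size_take dl -leqn0 leqNgt d0.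
have b0 : (0 < b)%N.
  case: b tb {sE} => // /(congr1 size) /eqP.
  by rewrite size_drop /= subn_eq0 leqNgt dl.
lia.
Qed.

Lemma out_letter_primitive (t u : 'I_l) :
  (forall k, out_letter (iter k (@ordS l) t) = out_letter (iter k (@ordS l) u)) -> t = u.
Proof.
wlog le_tu : t u / (t <= u)%N.
  move=> h; case/orP: (leq_total t u) => [/h//|/h ut k]; apply/esym/ut => j.
  by rewrite k.
move=> h; apply/ord_inj/eqP; rewrite eqn_leq le_tu leqNgt; apply/negP => lt_tu.
have ltu := ltn_ord u; apply: (@rot_neq (u - t)%N); first lia.
have x0 := out_letter t; apply: (@eq_from_nth _ x0); rewrite size_rot// => i il.
have [c cE] := iter_ordS_trans t (Ordinal il).
have := h c; rewrite -cE /out_letter !(tnth_nth x0) /= => ->.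
rewrite val_iter_ordS nth_cat size_drop.
have -> : ((u + c) %% l = (i + (u - t)) %% l)%N.
  have /= -> := congr1 val cE; rewrite val_iter_ordS modnDml; congr (_ %% _)%N; lia.
case: ltnP => hi.
  have hi' : (i + (u - t) < l)%N by rewrite addnC -ltn_subRL.
  by rewrite nth_drop (modn_small hi') addnC.
have uil : (i - (l - (u - t)) < l)%N by exact: leq_ltn_trans (leq_subr _ _) il.
have ule : (u - t <= l)%N by exact: leq_trans (leq_subr _ _) (ltnW ltu).
have iE : (i + (u - t) = (i - (l - (u - t))) + l)%N.
  by rewrite subnBA// subnK// addnC -leq_subLR.
rewrite nth_take; first by congr nth; rewrite iE modnDr modn_small.
by rewrite ltn_subLR// subnK.
Qed.

End Primitive.

Section CyclicallyReduced.
Hypothesis s_cyc : cyclically_reduced s.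

Lemma out_letter_ordS t : out_letter (ordS t) != inv_letter (out_letter t).
Proof.
have x0 := out_letter t; rewrite /out_letter !(tnth_nth x0) /=.
exact: cyclically_reduced_nth.
Qed.

Lemma out_neq_back t : out_letter t != back_letter t.
Proof. by have := out_letter_ordS (ord_pred t); rewrite ord_predK. Qed.

End CyclicallyReduced.
End CyclicWord.

(** * Trajectories of a frame along a cyclic word *)

Section Trajectories.
Variables (K : finFieldType) (r m n : nat) (s : seq (letter r)).
Local Notation l := (size s).
Local Notation G := {'GL_n.+1[K]}.
Local Notation out := (@out_letter r s).
Local Notation back := (@back_letter r s).
Hypothesis l_gt0 : (0 < l)%N.
Implicit Types (T : {ffun 'I_l -> 'M[K]_(m, n.+1)}) (g : {ffun 'I_r -> G}).

Let t0 : 'I_l := Ordinal l_gt0.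

Definition trajectory g T : bool :=
  [forall t, T t *m GLval (letter_eval g (out t)) == T (ordS t)].

Lemma trajectoryP g T :
  reflect (forall t, T t *m GLval (letter_eval g (out t)) = T (ordS t))
    (trajectory g T).
Proof. by apply: (iffP forallP) => h t; apply/eqP. Qed.

Definition unfold_trajectory g (A : 'M[K]_(m, n.+1)) : {ffun 'I_l -> 'M[K]_(m, n.+1)} :=
  [ffun t : 'I_l => A *m GLval (\prod_(x <- take t s) letter_eval g x)%g].

Lemma unfold_trajectory0 g A : unfold_trajectory g A t0 = A.
Proof. by rewrite ffunE take0 big_nil mulmx1. Qed.

Lemma take_letter g (t : 'I_l) :
  (\prod_(x <- take t.+1 s) letter_eval g x)%g =
  ((\prod_(x <- take t s) letter_eval g x) * letter_eval g (out t))%g.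
Proof.
have x0 := out t.
by rewrite (take_nth x0) ?ltn_ord// -cats1 big_cat big_seq1 /out (tnth_nth x0).
Qed.

(** Multiplying a frame by the successive prefixes of the word unfolds it, and the
unfolding closes up exactly when the frame is fixed by the word. *)
Lemma card_fixed_trajectory g :
  #|[set A : 'M[K]_(m, n.+1) | row_free A &&
      (A *m GLval (\prod_(x <- s) letter_eval g x)%g == A)]| =
  #|[set T : {ffun 'I_l -> 'M[K]_(m, n.+1)} | row_free (T t0) && trajectory g T]|.
Proof.
have uK : cancel (unfold_trajectory g) (fun T => T t0) := unfold_trajectory0 g.
rewrite -(card_imset _ (can_inj uK)).
congr #|pred_of_set _|; apply/setP => T; rewrite [RHS]inE.
have ordSE (t : 'I_l) : (t.+1 < l)%N -> ordS t = t.+1 :> nat by move=> tl; rewrite /= modn_small.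
apply/imsetP/andP => [[A + ->]|[T0 /trajectoryP Tt]].
  rewrite inE => /andP[fA /eqP Aw]; rewrite unfold_trajectory0; split=> //.
  apply/trajectoryP => t; rewrite !ffunE -mulmxA -GLvalM -take_letter.
  have [tl|lt] := ltnP t.+1 l; first by rewrite ordSE.
  have tE : t.+1 = l by apply/eqP; rewrite eqn_leq lt ltn_ord.
  by rewrite tE take_size Aw /= tE modnn take0 big_nil mulmx1.
have TE k (kl : (k < l)%N) :
    T (Ordinal kl) = T t0 *m GLval (\prod_(x <- take k s) letter_eval g x)%g.
  elim: k kl => [|k IH] kl.
    by rewrite take0 big_nil mulmx1; congr (T _); apply: val_inj.
  rewrite (take_letter g (Ordinal (ltnW kl))) GLvalM mulmxA -(IH (ltnW kl)) Tt; congr (T _).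
  by apply: val_inj; rewrite /= modn_small.
exists (T t0); last by apply/ffunP => -[k kl]; rewrite ffunE -TE.
rewrite inE T0; apply/eqP; pose u : 'I_l := ord_pred t0.
have uE : u.+1 = l by rewrite /= add0n modn_small prednK.
have -> : (\prod_(x <- s) letter_eval g x)%g =
    ((\prod_(x <- take u s) letter_eval g x) * letter_eval g (out u))%g.
  by rewrite -take_letter uE take_size.
rewrite GLvalM mulmxA.
have -> : T t0 *m GLval (\prod_(x <- take u s) letter_eval g x)%g = T u.
  by rewrite -(TE u (ltn_ord u)); congr (T _); apply: val_inj.
by rewrite Tt /u ord_predK.
Qed.

Local Notation word_star := (@star 'I_l ('I_r * bool)%type out back).
Local Notation word_move := (@move_along 'I_l ('I_r * bool)%type out (@ordS l) (@ord_pred l)).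

Lemma trajectory_move g T y t : trajectory g T -> t \in word_star y ->
  T t *m GLval (letter_eval g y) = T (word_move y t).
Proof.
move=> /trajectoryP Tt; rewrite inE /move_along.
have [<- _|_ /= /eqP bt] := eqVneq; first exact: Tt.
have := Tt (ord_pred t); rewrite ord_predK => <-.
rewrite -mulmxA -GLvalM -bt /back_letter letter_evalV mulgV.
by rewrite mulmx1.
Qed.

(** The conditions sorted by generators instead of positions: a step along an inverse
letter is a condition on the generator read backwards.  The conditions on
different generators are independent. *)
Lemma trajectory_family g T : cyclically_reduced s ->
  trajectory g T = (g \in family (fun i =>
    movers T (T \o word_move (i, false)) (word_star (i, false)))).
Proof.
move=> cs; apply/idP/familyP => [tT i|h].
  by apply/moversP => t ti; exact: (trajectory_move tT ti).
apply/trajectoryP => t; case oE: (out t) => [i []].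
  have oS : out (ordS t) != (i, false).
    have := out_neq_back cs (ordS t); rewrite back_letter_ordS oE.
    by [].
  have tS : ordS t \in word_star (i, false).
    by rewrite inE back_letter_ordS oE /inv_letter /= eqxx orbT.
  have <- : T (ordS t) *m GLval (g i) = T t.
    by rewrite (moversP _ _ _ _ (h i))// /= /move_along (negbTE oS) ordSK.
  by rewrite -mulmxA -GLvalM mulgV mulmx1.
have tS : t \in word_star (i, false) by rewrite inE oE eqxx.
by have := moversP _ _ _ _ (h i) _ tS; rewrite /= /move_along oE eqxx.
Qed.

Hypothesis s_cyc : cyclically_reduced s.
Let invK : involutive (@inv_letter r : 'I_r * bool -> 'I_r * bool)%type := @inv_letterK r.
Let bS := @back_letter_ordS r s.
Let oNb := out_neq_back s_cyc.

Lemma sum_letters (F : ('I_r * bool)%type -> nat) :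
  (forall y, F (inv_letter y) = F y) ->
  (\sum_y F y = 2 * \sum_(i < r) F (i, false))%N.
Proof.
move=> FV; transitivity (\sum_(i < r) \sum_b F (i, b))%N.
  by rewrite pair_bigA; apply: eq_bigr => -[].
rewrite big_distrr/=.
by apply: eq_bigr => i _; rewrite big_bool/= -(FV (i, false)) /inv_letter/= mul2n addnn.
Qed.

Lemma card_star_sum : (\sum_(i < r) #|word_star (i, false)| = l)%N.
Proof.
apply/eqP; rewrite -(eqn_pmul2l (_ : 0 < 2)%N)//.
rewrite -(@sum_letters (fun y => #|word_star y|)); last first.
  exact: (card_star_inv invK (@ordSK l) (@ord_predK l) bS oNb).
rewrite -[X in _ == (2 * X)%N]card_ord -sum1_card.
rewrite -(@sum_star _ _ _ _ oNb (fun=> 1%N)).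
by apply/eqP/eq_bigr => y _; rewrite sum1_card.
Qed.

Hypothesis s_prim : forall k z, (2 <= k)%N -> s <> flatten (nseq k z).

(** This is [rk_reduced_cycle] for the spans of the entries of a trajectory.  A letter
and its inverse have stars of the same rank, so the ranks of all the stars add up
to twice the sum over the generators. *)
Lemma trajectory_rank g T : trajectory g T -> row_free (T t0) ->
  span_rank T setT = (l * m)%N \/
  (span_rank T setT < \sum_(i < r) span_rank T (word_star (i, false)))%N.
Proof.
move=> Tg T0.
have mv y (A : {set 'I_l}) : A \subset word_star y ->
    span_rank T (word_move y @: A) = span_rank T A.
  move=> /subsetP sA; apply: (span_rank_move (GLval_unitmx (letter_eval g y))) => t tA.
  exact/trajectory_move/sA.
have sumE := @sum_letters (fun y => span_rank T (word_star y)).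
have starV y : span_rank T (word_star (inv_letter y)) = span_rank T (word_star y).
  by rewrite -(@move_along_star _ _ _ _ _ _ _ invK (@ordSK l) (@ord_predK l) bS oNb) mv.
have {sumE} := sumE starV; set S := (\sum_(i < r) _)%N => sumE.
have [lt|ge] := ltnP (span_rank T setT) S; [by right|left].
have key := @rk_reduced_cycle _ _ (span_rank0 T) (@span_rankS _ _ _ _ T)
  (@span_rankUI _ _ _ _ T) _ _ _ _ _ _ invK (@inv_letter_neq r) (@ordSK l) (@ord_predK l)
  bS oNb (@iter_ordS_trans r s) (out_letter_primitive s_prim) mv _ t0.
rewrite key; first by rewrite card_ord span_rank1 (eqP T0).
by rewrite sumE leq_mul2l.
Qed.

Lemma span_rank_le T (A : {set 'I_l}) : (span_rank T A <= #|A| * m)%N.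
Proof.
rewrite -stack_rank; apply: leq_trans (rank_leq_row _) _.
by rewrite sum_nat_const card_ord.
Qed.

(** The blocks of a family of the largest possible rank are independent. *)
Lemma span_rank_generic T (A : {set 'I_l}) : span_rank T setT = (l * m)%N ->
  span_rank T A = (#|A| * m)%N.
Proof.
move=> TT; apply/eqP; rewrite eqn_leq span_rank_le/=.
have := span_rankUI T A (~: A); rewrite setUCr setICr span_rank0 TT addn0.
have := span_rank_le T (~: A).
have -> : (l * m = #|A| * m + #|~: A| * m)%N by rewrite -mulnDl cardsC card_ord.
by move=> h1 h2; rewrite -(leq_add2r (#|~: A| * m)) (leq_trans h2)// leq_add2l.
Qed.

Lemma card_generic :
  #|[set T : {ffun 'I_l -> 'M[K]_(m, n.+1)} | span_rank T setT == (l * m)%N]| =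
  row_free_count K (l * m) n.+1.
Proof.
have lmE : (l * m = \sum_(t < l) m)%N by rewrite sum_nat_const card_ord.
rewrite lmE /row_free_count.
pose h (A : 'M[K]_(\sum_(t < l) m, n.+1)) : {ffun 'I_l -> 'M[K]_(m, n.+1)} :=
  [ffun t => submxcol A t].
have hK : cancel h (fun T => \mxcol_(t < l) T t).
  by move=> A; rewrite -[RHS]submxcolK; apply/eq_mxcolP => t; rewrite ffunE.
have rkE T : \rank (\mxcol_(t < l) T t) = span_rank T [set: 'I_l].
  apply/eqP; rewrite eqn_leq !mxrankS//.
    by apply/row_span_subP => t _; move: t; apply: (elimT (mxcol_subP T _)).
  by apply/mxcol_subP => t; exact/row_span_sup.
rewrite -(card_imset _ (can_inj hK)); congr #|pred_of_set _|; apply/setP => T.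
rewrite inE; apply/idP/imsetP => [TT|[A + ->]].
  exists (\mxcol_(t < l) T t); first by rewrite inE /row_free rkE.
  by apply/ffunP => t; rewrite ffunE mxcolK.
by rewrite inE -rkE hK.
Qed.
End Trajectories.

(** * The expected number of fixed frames *)

Lemma span_rank_comp (K : fieldType) (I : finType) m n (T : I -> 'M[K]_(m, n)) f
  (S : {set I}) : span_rank (T \o f) S = span_rank T (f @: S).
Proof.
apply/eqP; rewrite eqn_leq !mxrankS//.
  by apply/row_span_subP => _ /imsetP[t tS ->]; exact: (row_span_sup (T \o f) tS).
by apply/row_span_subP => t tS; apply/(row_span_sup T)/imset_f.
Qed.

Section RowFreeAsymptotics.
Variables (R : realFieldType) (K : finFieldType).
Local Notation q := (#|K|%:R : R).

Lemma card_field_ge2 : (2 <= #|K|)%N.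
Proof. by apply/card_gt1P; exists 0, 1; split=> //; rewrite eq_sym oner_eq0. Qed.

Lemma q_gt0 : 0 < q. Proof. by rewrite ltr0n (leq_trans _ card_field_ge2). Qed.
Lemma q_ge2 : 2 <= q. Proof. by rewrite (ler_nat R 2) card_field_ge2. Qed.
Lemma q_ge1 : 1 <= q. Proof. by have := q_ge2; lra. Qed.

Lemma row_free_count_ratio d n : (d <= n)%N ->
  (row_free_count K d n)%:R = q ^+ (d * n) * \prod_(a < d) (1 - q ^+ a / q ^+ n).
Proof.
move=> dn; rewrite row_free_countE natr_prod mulnC exprM -[X in _ ^+ X](card_ord d) -prodr_const.
rewrite -big_split; apply: eq_bigr => a _ /=.
have an : (a <= n)%N by apply: leq_trans (ltnW (ltn_ord a)) dn.
rewrite natrB; last by rewrite leq_pexp2l// (leq_trans _ card_field_ge2).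
by rewrite !natrX mulrBr mulr1 mulrCA mulfV ?mulr1// expf_neq0// gt_eqF// q_gt0.
Qed.

(** The product of the factors [1 - q ^+ a / q ^+ n] is at least
[1 - q ^+ d / q ^+ n]: the subtracted terms grow at least by a factor 2, so
their sum is at most the next term. *)
Lemma row_free_count_ge d n : (d <= n)%N -> 2 * q ^+ d <= q ^+ n ->
  q ^+ (d * n) / 2 <= (row_free_count K d n)%:R.
Proof.
move=> dn Qn; rewrite row_free_count_ratio// ler_wpM2l ?exprn_ge0 ?(ltW q_gt0)//.
have Q0 : 0 < q ^+ n by rewrite exprn_gt0 ?q_gt0.
suff : forall e, (e <= d)%N -> 1 - q ^+ e / q ^+ n <= \prod_(a < e) (1 - q ^+ a / q ^+ n).
  move=> /(_ d (leqnn d)); apply: le_trans.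
  have : q ^+ d / q ^+ n <= 2^-1 by rewrite ler_pdivrMr// mulrC ler_pdivlMr// mulrC.
  lra.
elim=> [|e IH] ed; first by rewrite big_ord0 lerBlDr lerDl divr_ge0// ltW.
rewrite big_ord_recr/=; have {}IH := IH (ltnW ed).
have x0 : 0 <= q ^+ e / q ^+ n by rewrite divr_ge0 ?exprn_ge0 ?(ltW q_gt0)// ltW.
have x1 : q ^+ e.+1 / q ^+ n <= 1.
  rewrite ler_pdivrMr// mul1r (le_trans _ Qn)// (le_trans (_ : _ <= q ^+ d))//.
    by rewrite ler_weXn2l// q_ge1.
  by rewrite ler_peMl ?exprn_ge0 ?(ltW q_gt0)// ler1n.
have qx : q ^+ e.+1 / q ^+ n = q * (q ^+ e / q ^+ n) by rewrite exprS mulrA.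
move: x1; rewrite qx; move: IH x0; set x := q ^+ e / q ^+ n; move=> IH x0 x1.
have q2 := q_ge2; have x1' : 0 <= 1 - x by nra.
apply: le_trans (ler_wpM2r x1' IH); nra.
Qed.

End RowFreeAsymptotics.

Section MomentSum.
Variables (R : realFieldType) (K : finFieldType) (r m n : nat) (s : seq (letter r)).
Local Notation l := (size s).
Local Notation G := {'GL_n.+1[K]}.
Local Notation q := (#|K|%:R : R).
Local Notation out := (@out_letter r s).
Local Notation back := (@back_letter r s).
Local Notation word_star := (@star 'I_l ('I_r * bool)%type out back).
Local Notation word_move := (@move_along 'I_l ('I_r * bool)%type out (@ordS l) (@ord_pred l)).
Hypothesis l_gt0 : (0 < l)%N.
Let t0 : 'I_l := Ordinal l_gt0.
Hypothesis s_cyc : cyclically_reduced s.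
Hypothesis s_prim : forall k z, (2 <= k)%N -> s <> flatten (nseq k z).

Implicit Types T : {ffun 'I_l -> 'M[K]_(m, n.+1)}.

(** The probability that independent uniform generators move every entry of [T] to the
next one. *)
Definition trajectory_prob (T : {ffun 'I_l -> 'M[K]_(m, n.+1)}) : R :=
  \prod_(i < r)
    (#|movers T (T \o word_move (i, false)) (word_star (i, false))|%:R / #|{: G}|%:R).

Definition fixed_frames (g : {ffun 'I_r -> G}) (w : seq (letter r)) : {set 'M[K]_(m, n.+1)} :=
  [set A | row_free A && (A *m GLval (\prod_(x <- w) letter_eval g x)%g == A)].

Lemma expected_frames :
  (\sum_(g : {ffun 'I_r -> G}) #|fixed_frames g s|)%:R / #|{: G}|%:R ^+ r =
  \sum_(T : {ffun 'I_l -> 'M[K]_(m, n.+1)} | row_free (T t0)) trajectory_prob T.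
Proof.
under eq_bigr do rewrite (card_fixed_trajectory _ l_gt0) -sum1_card.
under eq_bigr do (under eq_bigl do rewrite inE).
rewrite (exchange_big_dep (fun T : {ffun 'I_l -> 'M[K]_(m, n.+1)} => row_free (T t0)))/=; last first.
  by move=> g T _ /andP[].
rewrite natr_sum mulr_suml; apply: eq_bigr => T T0.
rewrite (eq_bigl (mem (family (fun i => movers T (T \o word_move (i, false)) (word_star (i, false)))))); last first.
  by move=> g; rewrite T0 /= trajectory_family.
rewrite sum1_card card_family foldrE big_map big_enum /= natr_prod.
by rewrite /trajectory_prob big_split/= prodfV prodr_const card_ord.
Qed.

Let cardG_gt0 : 0 < #|{: G}|%:R :> R.
Proof. by rewrite ltr0n; apply/card_gt0P; exists 1%g. Qed.

Lemma row_free_count_gt0 d : (d <= n.+1)%N -> (0 < row_free_count K d n.+1)%N.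
Proof.
move=> dn; rewrite row_free_countE prodn_gt0// => a.
by rewrite subn_gt0 ltn_exp2l ?card_field_ge2// (leq_trans (ltn_ord a)).
Qed.

Lemma trajectory_prob_generic T : (l * m <= n.+1)%N -> span_rank T [set: 'I_l] = (l * m)%N ->
  trajectory_prob T = \prod_(i < r) (row_free_count K (#|word_star (i, false)| * m) n.+1)%:R^-1.
Proof.
move=> lmn TT; apply: eq_bigr => i _.
have cE (A : {set 'I_l}) : (#|A| * m = \sum_(k < #|A|) m)%N by rewrite sum_nat_const card_ord.
have cm : (#|movers T (T \o word_move (i, false)) (word_star (i, false))| *
    row_free_count K (#|word_star (i, false)| * m) n.+1 = #|{: G}|)%N.
  rewrite cE; apply: card_movers; first by rewrite -cE; exact: span_rank_generic.
  rewrite -cE span_rank_comp (@move_along_star _ _ _ _ _ _ _ (@inv_letterK r) (@ordSK l) (@ord_predK l)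
    (@back_letter_ordS r s) (out_neq_back s_cyc)).
  rewrite (span_rank_generic _ TT) (card_star_inv (@inv_letterK r) (@ordSK l) (@ord_predK l)
    (@back_letter_ordS r s) (out_neq_back s_cyc)).
  by [].
have rf0 : 0 < (row_free_count K (#|word_star (i, false)| * m) n.+1)%:R :> R.
  rewrite ltr0n row_free_count_gt0// (leq_trans _ lmn)// leq_mul2r.
  by rewrite -[X in (_ <= X)%N]card_ord max_card orbT.
apply: (mulIf (lt0r_neq0 rf0)); rewrite mulVf ?lt0r_neq0// mulrAC -natrM cm divff//.
exact: lt0r_neq0.
Qed.

(** By [trajectory_rank] the exponents of the bounds for the single generators add up
to more than the rank of the family; this extra factor makes all the non-generic
families negligible together. *)
Lemma trajectory_prob_nongeneric T : (l * m <= n.+1)%N -> 2 * q ^+ (l * m) <= q ^+ n.+1 ->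
  row_free (T t0) -> span_rank T [set: 'I_l] != (l * m)%N ->
  trajectory_prob T <= 2 ^+ r / (q ^+ n.+1) ^+ (span_rank T [set: 'I_l]).+1.
Proof.
move=> lmn Qn T0 TT.
have Q1 : 1 <= q ^+ n.+1 by rewrite exprn_ege1// q_ge1.
have Q0 : 0 < q ^+ n.+1 by apply: lt_le_trans Q1.
have [->|] := eqVneq (trajectory_prob T) 0.
  by rewrite divr_ge0 ?exprn_ge0 ?(ltW Q0).
(* A family that is followed with positive probability is a trajectory. *)
move=> P0; have [g gT] : exists g : {ffun 'I_r -> G}, trajectory g T.
  pose F i := movers T (T \o word_move (i, false)) (word_star (i, false)).
  have Fne i : exists x, x \in F i.
    apply/card_gt0P; rewrite lt0n; apply: contraNneq P0 => Fi.
    by rewrite /trajectory_prob (bigD1 i)//= -/(F i) Fi !mul0r.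
  have [f fP] := fin_all_exists Fne.
  exists [ffun i => f i]; rewrite (trajectory_family _ _ s_cyc); apply/familyP => i.
  by rewrite ffunE; exact: fP.
have [/eqP|lt] := trajectory_rank s_cyc s_prim gT T0; first by rewrite (negbTE TT).
have dle (A : {set 'I_l}) : (span_rank T A <= l * m)%N.
  apply: leq_trans (span_rank_le _ _) _; rewrite leq_mul2r.
  by rewrite -[X in (_ <= X)%N]card_ord max_card orbT.
apply: (@le_trans _ _ (\prod_(i < r) (2 / (q ^+ n.+1) ^+ span_rank T (word_star (i, false))))).
  apply: ler_prod => i _; rewrite divr_ge0 ?ler0n//=.
  set d := span_rank T _; have := card_movers_le T (T \o word_move (i, false)) (word_star (i, false)).
  rewrite -/d; set c := #|movers _ _ _| => cle.
  have rfge : (q ^+ n.+1) ^+ d / 2 <= (row_free_count K d n.+1)%:R.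
    rewrite -exprM mulnC; apply: row_free_count_ge; first exact: leq_trans (dle _) lmn.
    apply: le_trans Qn; rewrite ler_pM2l// ler_weXn2l ?q_ge1//; exact: dle.
  rewrite ler_pdivrMr// mulrC mulrA ler_pdivlMr ?exprn_gt0 ?q_gt0//.
  move: cle; rewrite -(ler_nat R) natrM => cle.
  have : c%:R * ((q ^+ n.+1) ^+ d / 2) <= #|{: G}|%:R.
    by apply: le_trans cle; rewrite ler_wpM2l.
  by rewrite mulrA ler_pdivrMr.
rewrite big_split/= prodr_const card_ord prodfV -expr_sum ler_wpM2l ?exprn_ge0//.
rewrite lef_pV2 ?posrE ?exprn_gt0 ?q_gt0//; exact: ler_weXn2l.
Qed.

(** The number of families of full rank times the common value of their probabilities. *)
Definition generic_moment : R :=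
  (row_free_count K (l * m) n.+1)%:R *
  \prod_(i < r) (row_free_count K (#|word_star (i, false)| * m) n.+1)%:R^-1.

Lemma expected_frames_bound : (l * m <= n.+1)%N -> 2 * q ^+ (l * m) <= q ^+ n.+1 ->
  `|(\sum_(g : {ffun 'I_r -> G}) #|fixed_frames g s|)%:R / #|{: G}|%:R ^+ r - generic_moment|
  <= (\sum_(d < l * m) 2 ^+ r * (q ^+ (m * d)) ^+ l) / q ^+ n.+1.
Proof.
move=> lmn Qn; rewrite expected_frames.
have Q1 : 1 <= q ^+ n.+1 by rewrite exprn_ege1// q_ge1.
have Q0 : 0 < q ^+ n.+1 by apply: lt_le_trans Q1.
rewrite (bigID (fun T : {ffun 'I_l -> 'M[K]_(m, n.+1)} => span_rank T [set: 'I_l] == (l * m)%N))/=.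
have -> : \sum_(T : {ffun 'I_l -> 'M[K]_(m, n.+1)} | row_free (T t0) &&
     (span_rank T [set: 'I_l] == (l * m)%N)) trajectory_prob T = generic_moment.
  rewrite (eq_bigl (mem [set T : {ffun 'I_l -> 'M[K]_(m, n.+1)} |
      span_rank T [set: 'I_l] == (l * m)%N])); last first.
    move=> T; rewrite !inE andbC; case: eqP => //= TT.
    by rewrite /row_free -(span_rank1 T) (span_rank_generic _ TT) cards1 mul1n eqxx.
  rewrite (eq_bigr (fun=> \prod_(i < r) (row_free_count K (#|word_star (i, false)| * m) n.+1)%:R^-1)).
    by rewrite sumr_const card_generic /generic_moment mulr_natl.
  by move=> T /=; rewrite inE => /eqP TT; exact: (trajectory_prob_generic lmn TT).
rewrite addrAC subrr add0r ger0_norm; last first.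
  by apply: sumr_ge0 => T _; apply: prodr_ge0 => i _; rewrite divr_ge0.
(* The families are grouped by their rank; the full rank [ord_max] has been removed. *)
pose rkT (T : {ffun 'I_l -> 'M[K]_(m, n.+1)}) : 'I_(l * m).+1 := inord (span_rank T [set: 'I_l]).
have dle (T : {ffun 'I_l -> 'M[K]_(m, n.+1)}) : (span_rank T [set: 'I_l] <= l * m)%N.
  by apply: leq_trans (span_rank_le _ _) _; rewrite cardsT card_ord.
apply: (@le_trans _ _ (\sum_(T : {ffun 'I_l -> 'M[K]_(m, n.+1)} | rkT T != ord_max)
   2 ^+ r / (q ^+ n.+1) ^+ (span_rank T [set: 'I_l]).+1)).
  rewrite [leLHS]big_mkcond [leRHS]big_mkcond/=; apply: ler_sum => T _.
  have -> : (rkT T != ord_max) = (span_rank T [set: 'I_l] != (l * m)%N).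
    by rewrite -val_eqE /= inordK// ltnS.
  have rhs0 : 0 <= 2 ^+ r / (q ^+ n.+1) ^+ (span_rank T [set: 'I_l]).+1.
    by rewrite divr_ge0 ?exprn_ge0 ?(ltW Q0).
  case: eqP => [_|/eqP TT]; first by rewrite andbF.
  by case: ifP => [/andP[T0 _]|_]//; exact: trajectory_prob_nongeneric.
rewrite (partition_big rkT (fun d => d != ord_max))//= big_mkcond/= big_ord_recr/= eqxx addr0.
rewrite mulr_suml; apply: ler_sum => d _.
have -> : widen_ord (leqnSn (l * m)) d != ord_max by rewrite -val_eqE /= ltn_eqF.
rewrite (eq_bigr (fun=> 2 ^+ r / (q ^+ n.+1) ^+ d.+1)); last first.
  by move=> T /andP[_ /eqP/(congr1 val)]; rewrite /= inordK ?ltnS// => ->.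
rewrite sumr_const -[leLHS]mulr_natr.
have cd : #|[pred T | (rkT T != ord_max) && (rkT T == widen_ord (leqnSn (l * m)) d)]|%:R <=
    (q ^+ n.+1) ^+ d * (q ^+ (m * d)) ^+ l.
  rewrite -exprM -!natrX -natrM ler_nat [(n.+1 * d)%N]mulnC.
  apply: leq_trans (_ : #|[set T : {ffun 'I_l -> 'M[K]_(m, n.+1)} | span_rank T [set: 'I_l] == d]| <= _)%N.
    apply: subset_leq_card; apply/subsetP => T; rewrite !inE => /andP[_ /eqP/(congr1 val)].
    by rewrite /= inordK ?ltnS// => ->.
  by apply: leq_trans (card_span_rank _ _ _ _ _) _; rewrite card_ord.
apply: (@le_trans _ _ (2 ^+ r / (q ^+ n.+1) ^+ d.+1 *
    ((q ^+ n.+1) ^+ d * (q ^+ (m * d)) ^+ l))).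
  apply: ler_wpM2l; last exact: cd.
  by rewrite divr_ge0 ?exprn_ge0 ?(ltW Q0).
rewrite exprS; set X := q ^+ n.+1 in Q0 *; set Y := (q ^+ (m * d)) ^+ l.
have Xd : X ^+ d != 0 by rewrite expf_neq0// gt_eqF.
have X0 : X != 0 by rewrite gt_eqF.
rewrite le_eqVlt; apply/orP; left; apply/eqP; field.
by rewrite X0 Xd.
Qed.

End MomentSum.
From mathcomp Require Import all_classical all_reals all_analysis.
From mathcomp Require Import measurable_realfun.
Import numFieldNormedType.Exports.
Local Open Scope classical_set_scope.

(** * Convergence of the frame moments *)

Section MomentLimit.
Variables (R : realType) (K : finFieldType).
Local Notation q := (#|K|%:R : R).

Lemma cvg_invq : (q ^+ n.+1)^-1 @[n --> \oo] --> (0 : R).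
Proof.
have q0 := q_gt0 R K; have q2 := q_ge2 R K.
have : q^-1 ^+ n @[n --> \oo] --> (0 : R).
  by apply: cvg_expr; rewrite gtr0_norm ?invr_gt0// invf_lt1//; lra.
rewrite -(cvg_shiftS (fun n => q^-1 ^+ n)).
by under eq_fun do rewrite exprVn.
Qed.

Lemma near_q_ge (x : R) : \forall n \near \oo, x <= q ^+ n.+1.
Proof.
have e0 : 0 < (`|x| + 1)^-1 by rewrite invr_gt0 ltr_wpDl.
near=> n; have : `|(q ^+ n.+1)^-1| < (`|x| + 1)^-1.
  by near: n; exact: (@cvgr0_norm_lt _ _ _ _ _ _ cvg_invq _ e0).
have Q0 : 0 < q ^+ n.+1 by rewrite exprn_gt0 ?q_gt0.
rewrite gtr0_norm ?invr_gt0// ltf_pV2 ?posrE ?ltr_wpDl// => /ltW; apply: le_trans.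
by have := ler_norm x; lra.
Unshelve. all: by end_near. Qed.

Lemma row_free_ratio_cvg d :
  \prod_(a < d) (1 - q ^+ a / q ^+ n.+1) @[n --> \oo] --> (1 : R).
Proof.
rewrite -[X in _ --> X](@big1_eq R 1 *%R 'I_d (index_enum _) xpredT).
apply: cvg_big => [|a _]; first exact: mul_continuous.
rewrite -[X in _ --> X]subr0; apply: cvgB; first exact: cvg_cst.
by rewrite -(mulr0 (q ^+ a)); apply: cvgMr; exact: cvg_invq.
Qed.

Variables (r m : nat) (s : seq (letter r)).
Local Notation l := (size s).
Hypothesis l_gt0 : (0 < l)%N.
Hypothesis s_cyc : cyclically_reduced s.
Hypothesis s_prim : forall k z, (2 <= k)%N -> s <> flatten (nseq k z).

(** The exponents of [q] cancel because the stars of the generators cover every edge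
of the cycle once; what remains are finite products with limit 1. *)
Lemma generic_moment_cvg : generic_moment R K m n s @[n --> \oo] --> (1 : R).
Proof.
pose c (i : 'I_r) := (#|star (@out_letter r s) (@back_letter r s) (i, false)| * m)%N.
pose phi d n : R := \prod_(a < d) (1 - q ^+ a / q ^+ n.+1).
have cle i : (c i <= l * m)%N.
  by rewrite leq_mul2r -[X in (_ <= X)%N]card_ord max_card orbT.
have csum : (\sum_(i < r) c i = l * m)%N.
  by rewrite -big_distrl/= (card_star_sum s_cyc).
have phi1 d : phi d n @[n --> \oo] --> (1 : R) by exact: row_free_ratio_cvg.
have lim : phi (l * m)%N n * \prod_(i < r) (phi (c i) n)^-1 @[n --> \oo] --> (1 : R).
  rewrite -[X in _ --> X]mulr1; apply: cvgM; first exact: phi1.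
  rewrite -[X in _ --> X](@big1_eq R 1 *%R 'I_r (index_enum _) xpredT).
  apply: cvg_big => [|i _]; first exact: mul_continuous.
  by rewrite -[X in _ --> X]invr1; apply: cvgV; [exact: oner_neq0|exact: phi1].
apply: cvg_trans lim; apply: near_eq_cvg; near=> n.
have ln : (l * m <= n.+1)%N by apply: leqW; near: n; exact: nbhs_infty_ge.
rewrite /generic_moment row_free_count_ratio//.
have -> : \prod_(i < r) (row_free_count K (c i) n.+1)%:R^-1 =
    (q ^+ (l * m * n.+1))^-1 * \prod_(i < r) (phi (c i) n)^-1.
  rewrite -csum big_distrl/= -prodrXr -prodfV -big_split/=; apply: eq_bigr => i _.
  by rewrite row_free_count_ratio ?(leq_trans (cle i))// invfM.
by rewrite -/(phi _ _) mulrACA divff ?mul1r// expf_neq0// gt_eqF// q_gt0.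
Unshelve. all: by end_near. Qed.

Lemma expected_frames_cvg :
  ((\sum_(g : {ffun 'I_r -> {'GL_n.+1[K]}}) #|fixed_frames m g s|)%:R /
    #|{: {'GL_n.+1[K]}}|%:R ^+ r) @[n --> \oo] --> (1 : R).
Proof.
pose c : R := \sum_(d < l * m) 2 ^+ r * (q ^+ (m * d)) ^+ l.
have clim : c / q ^+ n.+1 @[n --> \oo] --> (0 : R).
  by rewrite -(mulr0 c); apply: cvgMr; exact: cvg_invq.
have lo : generic_moment R K m n s - c / q ^+ n.+1 @[n --> \oo] --> (1 : R).
  by rewrite -[X in _ --> X]subr0; apply: cvgB => //; exact: generic_moment_cvg.
have hi : generic_moment R K m n s + c / q ^+ n.+1 @[n --> \oo] --> (1 : R).
  by rewrite -[X in _ --> X]addr0; apply: cvgD => //; exact: generic_moment_cvg.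
apply: squeeze_cvgr lo hi; near=> n.
rewrite -ler_distl; apply: expected_frames_bound => //.
  by apply: leqW; near: n; exact: nbhs_infty_ge.
by near: n; exact: near_q_ge.
Unshelve. all: by end_near. Qed.

End MomentLimit.

Section NonpowerMoment.
Variables (R : realType) (K : finFieldType) (r m : nat) (w : free_group r).
Hypotheses (w_neq1 : w <> 1%g) (w_nonpower : nonpower w).

(** Right multiplication by [u(g)] carries the frames fixed by [w(g)] to those fixed by
[v(g)]. *)
Lemma card_fixed_conj n (g : {ffun 'I_r -> {'GL_n.+1[K]}}) (u v : free_group r) :
  w = (u * v * u^-1)%g ->
  #|fixed_frames m g (val w)| = #|fixed_frames m g (val v)|.
Proof.
move=> wE; pose U := GLval (word_eval g u).
have Uinj : injective (fun A : 'M[K]_(m, n.+1) => A *m U).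
  by apply: row_free_inj; rewrite row_free_unit GLval_unitmx.
have wgE : (word_eval g w * word_eval g u = word_eval g u * word_eval g v)%g.
  by rewrite -!monoid.gmulfM wE mulgKV.
have wUE A : A *m GLval (word_eval g w) *m U = A *m U *m GLval (word_eval g v).
  by rewrite -!mulmxA -!GLvalM wgE.
have fU A : row_free (A *m U) = row_free A.
  by rewrite /row_free mxrankMfree// row_free_unit GLval_unitmx.
rewrite -(card_imset _ Uinj); apply: eq_card => B; rewrite [RHS]inE.
apply/imsetP/andP => [[A + ->]|[fB /eqP Bv]].
  by rewrite inE => /andP[fA /eqP Aw]; rewrite fU -wUE Aw.
have BU : B *m GLval (word_eval g u)^-1%g *m U = B.
  by rewrite -mulmxA -GLvalM mulVg mulmx1.
exists (B *m GLval (word_eval g u)^-1%g); last by rewrite BU.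
rewrite inE -fU BU fB; apply/eqP/Uinj.
by rewrite wUE BU.
Qed.

Lemma nonpower_moment_cvg :
  ((\sum_(g : {ffun 'I_r -> {'GL_n.+1[K]}}) #|fixed_frames m g (val w)|)%:R /
    #|{: {'GL_n.+1[K]}}|%:R ^+ r) @[n --> \oo] --> (1 : R).
Proof.
have [u [v [wE v_cyc v_gt0]]] := cyclic_reduction w_neq1.
under eq_fun do under eq_bigr do rewrite (card_fixed_conj _ wE).
apply: expected_frames_cvg => // k z k2.
exact: nonpower_word (nonpower_conj wE w_nonpower) k2.
Qed.

End NonpowerMoment.

(** * Gaussian binomials and inversion of the frame counts *)

Section FrameCount.
Variables (R : realFieldType) (q : R).
Hypothesis q_ge2 : 2 <= q.

(** The number of [i]-frames in a space of dimension [n] over a field with [q] elements.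
So [frames n i / frames i i] is the Gaussian binomial coefficient. *)
Definition frames (n i : nat) : R := \prod_(a < i) (q ^+ n - q ^+ a).

Let q_gt1 : 1 < q. Proof. by move: q_ge2; lra. Qed.
Let q_gt0 : 0 < q. Proof. by move: q_ge2; lra. Qed.
Let q_neq0 : q != 0. Proof. by rewrite gt_eqF. Qed.
Let qX_neq0 n : q ^+ n != 0. Proof. by rewrite expf_neq0. Qed.
Let qX_gt0 n : 0 < q ^+ n. Proof. by rewrite exprn_gt0. Qed.
Let qX_gt1 n : 1 < q ^+ n.+1. Proof. by rewrite exprn_egt1. Qed.

Lemma frames0 n : frames n 0 = 1. Proof. by rewrite /frames big_ord0. Qed.

Lemma framesSr n i : frames n i.+1 = frames n i * (q ^+ n - q ^+ i).
Proof. by rewrite /frames big_ord_recr. Qed.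

(** The factors other than the first one are multiples by [q] of those for [n] and [i]. *)
Lemma framesSS n i : frames n.+1 i.+1 = (q ^+ n.+1 - 1) * q ^+ i * frames n i.
Proof.
rewrite /frames big_ord_recl expr0 -mulrA; congr (_ * _).
have -> : q ^+ i = \prod_(a < i) q by rewrite prodr_const card_ord.
rewrite -big_split; apply: eq_bigr => a _ /=.
by rewrite !exprS mulrBr.
Qed.

Lemma frames_eq0 n i : (n < i)%N -> frames n i = 0.
Proof. by move=> ni; rewrite /frames (bigD1 (Ordinal ni))//= subrr mul0r. Qed.

Lemma frames_ge0 n i : 0 <= frames n i.
Proof.
have [/frames_eq0->//|le_in] := ltnP n i.
apply: prodr_ge0 => a _; rewrite subr_ge0 ler_weXn2l ?(ltW q_gt1)//.
exact: leq_trans (ltnW (ltn_ord a)) le_in.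
Qed.

Lemma frames_gt0 n i : (i <= n)%N -> 0 < frames n i.
Proof.
move=> le_in; apply: prodr_gt0 => a _; rewrite subr_gt0 ltr_eXn2l//.
exact: leq_trans (ltn_ord a) le_in.
Qed.

Let fr_neq0 i : frames i i != 0. Proof. by rewrite gt_eqF ?frames_gt0. Qed.

(** A frame is extended by a frame of the quotient by its span, up to a choice of
lifts. *)
Lemma frames_add k u j :
  frames (k + u) (k + j) = frames (k + u) k * (q ^+ (k * j) * frames u j).
Proof.
elim: j => [|j IH]; first by rewrite addn0 muln0 frames0 expr0 !mulr1.
rewrite addnS framesSr IH framesSr mulnS exprD !exprD; ring.
Qed.

Lemma gauss_pascal n i :
  frames n.+1 i.+1 / frames i.+1 i.+1 =
  frames n i / frames i i + q ^+ i.+1 * (frames n i.+1 / frames i.+1 i.+1).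
Proof.
rewrite (framesSS n i) (framesSS i i) (framesSr n i).
have q1 : q ^+ i.+1 - 1 != 0 by rewrite gt_eqF// subr_gt0.
have f0 := fr_neq0 i; have x0 := qX_neq0 i.
move: q1; rewrite !exprS; set f := frames i i in f0 *; set x := q ^+ i in x0 *; move=> q1.
by field; rewrite f0 x0 q1.
Qed.

(** By Pascal's rule the alternating sums telescope, as for ordinary binomial
coefficients. *)
Lemma alternating_gauss_sum n L :
  \sum_(j < L.+1) (-1) ^+ j * q ^+ 'C(j, 2) * (frames n.+1 j / frames j j) =
  (-1) ^+ L * q ^+ 'C(L.+1, 2) * (frames n L / frames L L).
Proof.
elim: L => [|L IH].
  by rewrite big_ord_recr big_ord0/= !frames0 add0r !expr0.
rewrite big_ord_recr/= IH gauss_pascal [in RHS]binS bin1 exprD exprS.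
set f := frames n L / _; set h := frames n L.+1 / _; ring.
Qed.

(** The coefficient of [frames n (k + j)] in the inversion of the Gaussian binomial
transform; for [k = 0] this is Moebius inversion on the lattice of subspaces. *)
Definition inversion_coef (k j : nat) : R :=
  (-1) ^+ j * q ^+ 'C(j, 2) / (frames k k * q ^+ (k * j) * frames j j).

Lemma inversion_coef_frames k u j : inversion_coef k j * frames (k + u) (k + j) =
  frames (k + u) k / frames k k * ((-1) ^+ j * q ^+ 'C(j, 2) * (frames u j / frames j j)).
Proof.
rewrite /inversion_coef frames_add.
have := fr_neq0 k; have := fr_neq0 j; have := qX_neq0 (k * j).
move: (frames k k) (frames j j) (q ^+ (k * j)) => a b c a0 b0 c0.
by field; rewrite a0 b0 c0.
Qed.

(** For [n > k] the partial sum is a single signed term by [alternating_gauss_sum], and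
Pascal's rule bounds it by the first omitted term. *)
Lemma inversion_bonferroni k n L :
  `|\sum_(j < L.+1) inversion_coef k j * frames n (k + j) - (n == k)%:R|
  <= `|inversion_coef k L.+1| * frames n (k + L.+1).
Proof.
have [nk|kn] := ltnP n k.
  rewrite big1 => [|j _]; first by rewrite ltn_eqF// subrr normr0 mulr_ge0 ?frames_ge0.
  by rewrite frames_eq0 ?mulr0// (leq_trans nk)// leq_addr.
rewrite -(subnKC kn); move: (n - k)%N => u {n kn}.
under eq_bigr do rewrite inversion_coef_frames.
rewrite -mulr_sumr; have rhs0 j : 0 <= `|inversion_coef k j| * frames (k + u) (k + j).
  by rewrite mulr_ge0 ?frames_ge0.
case: u rhs0 => [|u] rhs0.
  rewrite big_ord_recl /= big1 => [|j _]; last by rewrite frames_eq0// mul0r mulr0.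
  rewrite !frames0 addn0 eqxx expr0 divff ?oner_neq0// addr0 !mulr1 divff//.
  by rewrite !mulr1 subrr normr0; have := rhs0 L.+1; rewrite addn0.
rewrite alternating_gauss_sum -[X in _ - X%:R]/(nat_of_bool (k + u.+1 == k)).
have -> : (k + u.+1 == k) = false by rewrite -[X in _ == X]addn0 eqn_add2l.
rewrite subr0 -[X in _ <= X]ger0_norm; last exact: rhs0.
rewrite [leRHS]normrM normr_id -[leRHS]normrM inversion_coef_frames.
rewrite [leLHS]normrM [leRHS]normrM; apply: ler_wpM2l => //.
have sgnE i : `|(-1) ^+ i * q ^+ 'C(L.+1, 2)| = q ^+ 'C(L.+1, 2).
  by rewrite normrM normrX normrN1 expr1n mul1r gtr0_norm.
rewrite [leLHS]normrM [leRHS]normrM !sgnE; apply: ler_wpM2l; first exact: ltW.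
rewrite gauss_pascal; set f := frames u L / _; set h := _ * _.
have f0 : 0 <= f by rewrite divr_ge0 ?frames_ge0.
have h0 : 0 <= h by rewrite mulr_ge0 ?divr_ge0 ?frames_ge0// ltW.
by rewrite !ger0_norm ?addr_ge0// lerDl.
Qed.

End FrameCount.

(** * Euler's product *)

Section EulerProduct.
Variables (R : realType) (q : R).
Hypothesis q_ge2 : 2 <= q.
Local Notation frames := (frames q).

Let q_gt1 : 1 < q. Proof. by move: q_ge2; lra. Qed.
Let q_gt0 : 0 < q. Proof. by move: q_ge2; lra. Qed.
Let q_neq0 : q != 0. Proof. by rewrite gt_eqF. Qed.
Let qX_neq0 n : q ^+ n != 0. Proof. by rewrite expf_neq0. Qed.
Let qX_gt0 n : 0 < q ^+ n. Proof. by rewrite exprn_gt0. Qed.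
Let qX_gt1 n : 1 < q ^+ n.+1. Proof. by rewrite exprn_egt1. Qed.
Let qX1_neq0 n : q ^+ n.+1 - 1 != 0. Proof. by rewrite gt_eqF// subr_gt0. Qed.
Let fr_neq0 i : frames i i != 0. Proof. by rewrite gt_eqF ?frames_gt0. Qed.

Let series0 (u : R ^nat) : series u 0%N = 0.
Proof. by rewrite /series /= big_geq. Qed.

(** The inverse of the product of [q ^+ i - 1] for [1 <= i <= j]. *)
Definition euler_coef (j : nat) : R := q ^+ 'C(j, 2) / frames j j.

Lemma euler_coef_ge0 j : 0 <= euler_coef j.
Proof. by rewrite divr_ge0 ?frames_ge0// ltW. Qed.

Lemma euler_coefS j : euler_coef j.+1 = euler_coef j / (q ^+ j.+1 - 1).
Proof.
rewrite /euler_coef framesSS binS bin1 exprD.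
by field; rewrite fr_neq0 qX_neq0 qX1_neq0.
Qed.

(** From the second one on, every factor [q ^+ i - 1] is at least 2. *)
Lemma euler_coef_le j : euler_coef j <= 2 / 2 ^+ j.
Proof.
have P i : 0 < 2 ^+ i :> R by rewrite exprn_gt0.
have b0 : euler_coef 0 = 1 by rewrite /euler_coef frames0 divr1 expr0.
case: j => [|j]; first by rewrite b0 expr0; lra.
elim: j => [|j IH]; rewrite euler_coefS.
  by rewrite b0 !expr1 divff// div1r invf_le1; move: q_ge2; lra.
rewrite [2 ^+ _]exprSr invfM mulrA ler_pM ?euler_coef_ge0 ?invr_ge0//.
  by rewrite subr_ge0; exact/ltW/qX_gt1.
have q4 : 4 <= q ^+ j.+2.
  rewrite (le_trans (_ : _ <= q ^+ 2))//; first by rewrite expr2; move: q_ge2; nra.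
  by rewrite ler_weXn2l// ltW.
by rewrite lef_pV2 ?posrE//; lra.
Qed.

(** The terms of Euler's expansion of the product of [1 - q ^- i] over [i > k]. *)
Definition euler_term (k j : nat) : R := (-1) ^+ j * euler_coef j / q ^+ (k * j).
Definition euler (k : nat) : R := limn (series (euler_term k)).

Lemma euler_termE k j : inversion_coef q k j = euler_term k j / frames k k.
Proof.
rewrite /inversion_coef /euler_term /euler_coef.
by field; rewrite !fr_neq0 qX_neq0.
Qed.

Lemma normr_euler_term_le k j : `|euler_term k j| <= 2 / 2 ^+ j / q ^+ (k * j).
Proof.
rewrite /euler_term 2!normrM normrX normrN1 expr1n mul1r.
rewrite ger0_norm ?euler_coef_ge0// ger0_norm ?invr_ge0 ?(ltW (qX_gt0 _))//.
by rewrite ler_wpM2r ?euler_coef_le// invr_ge0 ltW.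
Qed.

Lemma euler_cvg k : series (euler_term k) @ \oo --> euler k.
Proof.
suff : cvgn (series (euler_term k)) by [].
apply: normed_cvg; apply: (@series_le_cvg _ _ (geometric 2 2^-1)) => //.
- by move=> n; exact: normr_ge0.
- by move=> n; rewrite /geometric /= mulr_ge0// exprn_ge0// invr_ge0.
- move=> n /=; apply: le_trans (normr_euler_term_le k n) _.
  rewrite exprVn ler_pdivrMr// ler_peMr ?divr_ge0 ?exprn_ge0//.
  by rewrite exprn_ege1// ltW.
apply: is_cvg_geometric_series; rewrite gtr0_norm ?invr_gt0//; lra.
Qed.

(** Euler's functional equation f(x) = (1 - x / q) f(x / q), for the partial sums of the
series at x = q ^- k. *)
Lemma euler_term_rec k L : series (euler_term k) L.+1 =
  series (euler_term k.+1) L.+1 - q ^- k.+1 * series (euler_term k.+1) L.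
Proof.
elim: L => [|L IH].
  by rewrite !seriesSr !series0 /euler_term !muln0 mulr0 subr0.
rewrite seriesSr IH [in RHS]seriesSr (seriesSr _ L).
suff -> : euler_term k L.+1 = euler_term k.+1 L.+1 - q ^- k.+1 * euler_term k.+1 L by ring.
rewrite /euler_term euler_coefS.
have -> : (k * L.+1 = k + k * L)%N by rewrite mulnS.
have -> : (k.+1 * L.+1 = k + k * L + L.+1)%N by rewrite mulSn mulnS; lia.
have -> : (k.+1 * L = k * L + L)%N by rewrite mulSn addnC.
have h := qX1_neq0 L; move: h; rewrite !exprD !exprS => h.
have := qX_neq0 k; have := qX_neq0 (k * L); have := qX_neq0 L.
move: (q ^+ k) (q ^+ (k * L)) (q ^+ L) h => x y z h z0 y0 x0.
by field; rewrite x0 y0 z0 q_neq0 h.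
Qed.

Lemma eulerS k : euler k = (1 - q ^- k.+1) * euler k.+1.
Proof.
have h : (fun L => series (euler_term k) L.+1) @ \oo --> euler k.
  by rewrite (cvg_shiftS (series (euler_term k))); exact: euler_cvg.
apply: (cvg_unique _ h) => //=.
under eq_fun do rewrite euler_term_rec.
rewrite mulrBl mul1r; apply: cvgB.
  by rewrite (cvg_shiftS (series (euler_term k.+1))); exact: euler_cvg.
by apply: cvgMr; exact: euler_cvg.
Qed.

(** The constant term is 1, and the others are bounded by a geometric series times
[q ^- k]. *)
Lemma euler_near1 k : `|euler k - 1| <= 2 / q ^+ k.
Proof.
have P i : 0 < 2 ^+ i :> R by rewrite exprn_gt0.
have bound L : `|series (euler_term k) L.+1 - 1| <= 2 / q ^+ k.
  suff : `|series (euler_term k) L.+1 - 1| <= (2 - 2 / 2 ^+ L) / q ^+ k.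
    move/le_trans; apply; rewrite ler_wpM2r ?invr_ge0 ?(ltW (qX_gt0 _))//.
    by rewrite gerBl divr_ge0 ?(ltW (P _)).
  elim: L => [|L IH].
    rewrite seriesSr series0 /euler_term /euler_coef frames0 muln0.
    by rewrite expr0 divr1 divff// !mulr1 add0r divr1 !subrr normr0 mul0r.
  rewrite seriesSr addrAC; apply: le_trans (ler_normD _ _) _.
  have tle : `|euler_term k L.+1| <= 2 / 2 ^+ L.+1 / q ^+ k.
    apply: le_trans (normr_euler_term_le _ _) _.
    rewrite ler_wpM2l ?divr_ge0 ?(ltW (P _))// lef_pV2 ?posrE//.
    by rewrite ler_weXn2l ?(ltW q_gt1)// mulnS leq_addr.
  apply: le_trans (lerD IH tle) _; rewrite -mulrDl ler_wpM2r ?invr_ge0 ?(ltW (qX_gt0 _))//.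
  have -> : 2 / 2 ^+ L = 2 * (2 / 2 ^+ L.+1) :> R.
    by rewrite exprS; field; rewrite gt_eqF.
  by move: (2 / 2 ^+ L.+1) => x; lra.
have h : (fun L => `|series (euler_term k) L.+1 - 1|) @ \oo --> `|euler k - 1|.
  apply: cvg_norm; apply: cvgB; last exact: cvg_cst.
  by rewrite (cvg_shiftS (series (euler_term k))); exact: euler_cvg.
rewrite -(cvg_lim _ h)//; apply: limr_le; first by apply: cvgP h.
by apply: nearW => L; exact: bound.
Qed.

Definition qprod (n : nat) : R := \prod_(1 <= i < n.+1) (1 - q ^- i).

Lemma qprod0 : qprod 0 = 1. Proof. by rewrite /qprod big_geq. Qed.

Lemma qprodS n : qprod n.+1 = qprod n * (1 - q ^- n.+1).
Proof. by rewrite /qprod big_nat_recr. Qed.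

Lemma qprod_gt0 n : 0 < qprod n.
Proof.
elim: n => [|n IH]; first by rewrite qprod0.
by rewrite qprodS mulr_gt0// subr_gt0 invf_lt1.
Qed.

Lemma qprod_euler n : qprod n * euler n = euler 0.
Proof.
elim: n => [|n IH]; first by rewrite qprod0 mul1r.
by rewrite qprodS -mulrA -eulerS.
Qed.

Lemma euler_to1 : euler n @[n --> \oo] --> (1 : R).
Proof.
have lim : 2 / q ^+ n @[n --> \oo] --> (0 : R).
  rewrite -(mulr0 2); apply: cvgMr.
  under eq_fun do rewrite -exprVn.
  by apply: cvg_expr; rewrite gtr0_norm ?invr_gt0// invf_lt1.
apply/cvgrPdist_le => e e0; near=> n.
rewrite distrC; apply: le_trans (euler_near1 n) _.
have Ln : `|2 / q ^+ n| < e by near: n; exact: (@cvgr0_norm_lt _ _ _ _ _ _ lim _ e0).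
by apply: le_trans (ler_norm _) (ltW Ln).
Unshelve. all: by end_near. Qed.

(** By the functional equation the partial product [qprod n] is [euler 0 / euler n], and
[euler n] tends to 1. *)
Lemma qprod_cvg : qprod n @[n --> \oo] --> euler 0.
Proof.
have lim : euler 0 / euler n @[n --> \oo] --> euler 0.
  rewrite -[X in _ --> X]mulr1; apply: cvgMr.
  by rewrite -[X in _ --> X]invr1; apply: cvgV; [exact: oner_neq0|exact: euler_to1].
apply: cvg_trans lim; apply: near_eq_cvg; near=> n.
have e0 : euler n != 0.
  rewrite gt_eqF//; near: n; apply: (cvgr_gt _ euler_to1); exact: ltr01.
by rewrite -(qprod_euler n) mulfK.
Unshelve. all: by end_near. Qed.

Lemma frames_qprod k : frames k k = q ^+ (k ^ 2)%N * qprod k.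
Proof.
elim: k => [|k IH]; first by rewrite frames0 qprod0 mulr1.
rewrite framesSS IH qprodS.
have -> : (k.+1 ^ 2 = k ^ 2 + k + k.+1)%N by rewrite !expnS !expn0; lia.
rewrite !exprD !exprS; have := qX_neq0 k; move: (q ^+ k) (q ^+ _) (qprod k) => x y z x0.
by field; rewrite x0 q_neq0.
Qed.

Definition limit_mass (k : nat) : R :=
  limn qprod * (q ^- (k ^ 2)%N / \prod_(1 <= i < k.+1) (1 - q ^- i) ^+ 2).

Lemma limit_massE k : limit_mass k = euler k / frames k k.
Proof.
rewrite /limit_mass (cvg_lim _ qprod_cvg)// prodrXl -/(qprod k) -(qprod_euler k) frames_qprod.
have := qprod_gt0 k => /lt0r_neq0; have := qX_neq0 (k ^ 2)%N.
by move: (q ^+ _) (qprod k) (euler k) => x y z x0 y0; field; rewrite x0 y0.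
Qed.

Lemma inversion_coef_sum_cvg k : \sum_(j < L.+1) inversion_coef q k j @[L --> \oo] --> limit_mass k.
Proof.
rewrite limit_massE.
have -> : (fun L => \sum_(j < L.+1) inversion_coef q k j) =
    (fun L => series (euler_term k) L.+1 / frames k k).
  apply/funext => L; rewrite /series/= big_mkord mulr_suml.
  by apply: eq_bigr => j _; rewrite euler_termE.
apply: cvgMl; rewrite (cvg_shiftS (series (euler_term k))); exact: euler_cvg.
Qed.

Lemma inversion_coef_cvg0 k : `|inversion_coef q k L| @[L --> \oo] --> (0 : R).
Proof.
have h : inversion_coef q k L @[L --> \oo] --> (0 : R).
  have -> : inversion_coef q k = (fun L => euler_term k L / frames k k).
    by apply/funext => L; rewrite euler_termE.
  rewrite -(mul0r (frames k k)^-1); apply: cvgMl.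
  apply: cvg_series_cvg_0; apply/cvg_ex; exists (euler k); exact: euler_cvg.
by rewrite -(normr0 R); apply: cvg_norm.
Qed.

End EulerProduct.

(** * From frame counts to masses *)

Lemma cvgn_near_dist (R : realType) (u : nat -> R) (l e : R) :
  u n @[n --> \oo] --> l -> 0 < e -> \forall n \near \oo, `|l - u n| <= e.
Proof. by move=> /cvgrPdist_le h /h. Qed.

(** Laws [p N] on the dimensions at most [N.+1] all of whose frame counts tend to 1. *)
Section MomentMethod.
Variables (R : realType) (q : R).
Hypothesis q_ge2 : 2 <= q.
Variable p : nat -> nat -> R.
Hypothesis p_ge0 : forall N k, 0 <= p N k.
Hypothesis p_out : forall N k, (N.+2 <= k)%N -> p N k = 0.
Hypothesis p_sum : forall N, \sum_(k < N.+2) p N k = 1.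
Hypothesis p_moment : forall m,
  \sum_(k < N.+2) p N k * frames q k m @[N --> \oo] --> (1 : R).

Let moment m N := \sum_(k < N.+2) p N k * frames q k m.

(** Average the inequality [inversion_bonferroni] over the law [p N]. *)
Lemma mass_sandwich k L N :
  `|\sum_(j < L.+1) inversion_coef q k j * moment (k + j) N - p N k|
  <= `|inversion_coef q k L.+1| * moment (k + L.+1) N.
Proof.
have pE : p N k = \sum_(n < N.+2) p N n * (nat_of_ord n == k)%:R.
  have [kN|Nk] := ltnP k N.+2; last first.
    rewrite p_out// big1// => n _; rewrite ltn_eqF ?mulr0//.
    exact: leq_trans (ltn_ord n) Nk.
  rewrite (bigD1 (Ordinal kN))//= eqxx mulr1 big1 ?addr0// => n nk.
  by rewrite (negbTE (_ : nat_of_ord n != k)) ?mulr0.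
have -> : \sum_(j < L.+1) inversion_coef q k j * moment (k + j) N =
    \sum_(n < N.+2) p N n * \sum_(j < L.+1) inversion_coef q k j * frames q n (k + j).
  rewrite /moment; under eq_bigr do rewrite mulr_sumr.
  rewrite exchange_big; apply: eq_bigr => n _ /=; rewrite mulr_sumr.
  by apply: eq_bigr => j _; rewrite mulrCA.
rewrite pE -sumrB /moment mulr_sumr; apply: le_trans (ler_norm_sum _ _ _) _.
apply: ler_sum => n _; rewrite -mulrBr normrM ger0_norm// mulrCA.
by rewrite ler_wpM2l// inversion_bonferroni.
Qed.

(** For a fixed truncation only finitely many frame counts occur, and these converge;
the truncation error is then small because [inversion_coef q k] tends to 0. *)
Lemma mass_cvg k : p N k @[N --> \oo] --> limit_mass q k.
Proof.
apply/cvgrPdist_le => e e0; have e4 : 0 < e / 4 by lra.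
have h2 : `|inversion_coef q k n.+1| @[n --> \oo] --> (0 : R).
  by rewrite (cvg_shiftS (fun L => `|inversion_coef q k L|)); exact: inversion_coef_cvg0.
have ev1 := cvgn_near_dist (@inversion_coef_sum_cvg _ _ q_ge2 k) e4.
have ev2 := cvgn_near_dist h2 e4.
near \oo => L.
have L1 : `|limit_mass q k - \sum_(j < L.+1) inversion_coef q k j| <= e / 4 by near: L.
have L2 : `|inversion_coef q k L.+1| <= e / 4.
  have : `|0 - `|inversion_coef q k L.+1| | <= e / 4 by near: L.
  by rewrite sub0r normrN normr_id.
have s1 : \sum_(j < L.+1) inversion_coef q k j * moment (k + j) N @[N --> \oo] -->
    \sum_(j < L.+1) inversion_coef q k j.
  under [X in _ --> X]eq_bigr do rewrite -[inversion_coef _ _ _]mulr1.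
  apply: cvg_big => [|j _]; first exact: add_continuous.
  by apply: cvgMr; exact: p_moment.
have s2 : moment (k + L.+1) N @[N --> \oo] --> (1 : R) by exact: p_moment.
near=> N.
have N1 : `|\sum_(j < L.+1) inversion_coef q k j - \sum_(j < L.+1) inversion_coef q k j * moment (k + j) N| <= e / 4.
  by near: N; exact: cvgn_near_dist s1 e4.
have N2 : moment (k + L.+1) N <= 2.
  have : `|1 - moment (k + L.+1) N| <= 1.
    by near: N; exact: cvgn_near_dist s2 ltr01.
  by rewrite ler_norml => /andP[? ?]; lra.
have N3 := mass_sandwich k L N.
have N4 : `|inversion_coef q k L.+1| * moment (k + L.+1) N <= e / 2.
  apply: le_trans (ler_wpM2l _ N2) _; first exact: normr_ge0.
  by move: L2; lra.
move: L1 N1 (le_trans N3 N4); set a := \sum_(j < L.+1) _; set b := \sum_(j < L.+1) _.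
move: (limit_mass q k) (p N k) => x y.
rewrite !ler_norml => /andP[? ?] /andP[? ?] /andP[? ?].
by apply/andP; split; lra.
Unshelve. all: by end_near. Qed.

Lemma limit_mass_ge0 k : 0 <= limit_mass q k.
Proof.
have h := @mass_cvg k; rewrite -(cvg_lim _ h)//.
by apply: limr_ge; [apply/cvg_ex; eexists; exact: h|apply: nearW => N].
Qed.

Lemma mass_tailE k N : (k <= N)%N ->
  1 - \sum_(j < k.+1) p N j = \sum_(k.+1 <= j < N.+2) p N j.
Proof.
move=> kN; rewrite -(p_sum N) -!(big_mkord xpredT (p N)) (@big_cat_nat _ _ _ k.+1)//=.
  by rewrite addrAC subrr add0r.
by rewrite !ltnS leqW.
Qed.

(** Markov's inequality for the number of non-zero fixed vectors. *)
Lemma mass_tail k N : (k <= N)%N ->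
  0 <= 1 - \sum_(j < k.+1) p N j <= moment 1 N / (q ^+ k.+1 - 1).
Proof.
move=> kN; have q1 : 1 < q ^+ k.+1 by rewrite exprn_egt1//; move: q_ge2; lra.
rewrite (mass_tailE kN) sumr_ge0 => [|j _]; last exact: p_ge0.
rewrite ler_pdivlMr ?subr_gt0// mulr_suml /moment.
rewrite -(big_mkord xpredT (fun j => p N j * frames q j 1)).
rewrite (@big_cat_nat _ _ _ k.+1 0 N.+2)//=; last by rewrite !ltnS leqW.
apply: (@le_trans _ _ (\sum_(k.+1 <= j < N.+2) p N j * frames q j 1)).
  rewrite !big_nat; apply: ler_sum => j /andP[kj _]; apply: ler_wpM2l => //.
  rewrite /frames big_ord1 expr0 lerD2r ler_weXn2l//; move: q_ge2; lra.
by rewrite lerDr sumr_ge0// => j _; rewrite mulr_ge0 ?frames_ge0.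
Qed.

Lemma limit_mass_tail k : 0 <= 1 - \sum_(j < k.+1) limit_mass q j <= 1 / (q ^+ k.+1 - 1).
Proof.
have lim1 : 1 - \sum_(j < k.+1) p N j @[N --> \oo] --> 1 - \sum_(j < k.+1) limit_mass q j.
  apply: cvgB; first exact: cvg_cst.
  by apply: cvg_big => [|j _]; [exact: add_continuous|exact: mass_cvg].
have lim2 : moment 1 N / (q ^+ k.+1 - 1) @[N --> \oo] --> 1 / (q ^+ k.+1 - 1).
  by apply: cvgMl; exact: p_moment.
apply/andP; split.
  rewrite -(cvg_lim _ lim1)//; apply: limr_ge; first by apply/cvg_ex; eexists; exact: lim1.
  near=> N; have kN : (k <= N)%N by near: N; exact: nbhs_infty_ge.
  by have /andP[] := mass_tail kN.
rewrite -(cvg_lim _ lim1)// -(cvg_lim _ lim2)//.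
apply: ler_lim; [by apply/cvg_ex; eexists; exact: lim1|by apply/cvg_ex; eexists; exact: lim2|].
near=> N; have kN : (k <= N)%N by near: N; exact: nbhs_infty_ge.
by have /andP[] := mass_tail kN.
Unshelve. all: by end_near. Qed.

Lemma limit_mass_sum : series (limit_mass q) @ \oo --> (1 : R).
Proof.
rewrite -cvg_shiftS /=.
have lim : 1 - q ^- k @[k --> \oo] --> (1 : R).
  rewrite -[X in _ --> X]subr0; apply: cvgB; first exact: cvg_cst.
  under eq_fun do rewrite -exprVn.
  by apply: cvg_expr; rewrite gtr0_norm ?invr_gt0 ?invf_lt1//; move: q_ge2; lra.
refine (squeeze_cvgr _ lim (cvg_cst (1 : R))); apply: nearW => k.
rewrite /series/= big_mkord; have /andP[h1 h2] := limit_mass_tail k.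
have q0 : 0 < q ^+ k by rewrite exprn_gt0//; move: q_ge2; lra.
have q1 : 1 <= q ^+ k by rewrite exprn_ege1//; move: q_ge2; lra.
have : 1 / (q ^+ k.+1 - 1) <= q ^- k.
  rewrite div1r lef_pV2 ?posrE//; rewrite exprS; move: q_ge2 q1; nra.
by move=> h3; apply/andP; split; lra.
Qed.

(** Convergence of the masses controls every finite part, and tightness the tails, for
all the laws at once. *)
Lemma average_cvg (F : nat -> R) (M S : R) : (forall k, `|F k| <= M) ->
  series (fun k => limit_mass q k * F k) @ \oo --> S ->
  \sum_(k < N.+2) p N k * F k @[N --> \oo] --> S.
Proof.
move=> FM FS; have M0 : 0 <= M by apply: le_trans (FM 0%N).
apply/cvgrPdist_le => e e0; have e3 : 0 < e / 3 by lra.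
have mcvg j := @mass_cvg j.
have FS1 : series (fun k => limit_mass q k * F k) k.+1 @[k --> \oo] --> S.
  by rewrite (cvg_shiftS (series (fun k => limit_mass q k * F k))).
have tail0 : M * (2 / (q ^+ k.+1 - 1)) @[k --> \oo] --> (0 : R).
  have up : M * 4 * q ^- k @[k --> \oo] --> (0 : R).
    rewrite -(mulr0 (M * 4)); apply: cvgMr; under eq_fun do rewrite -exprVn.
    by apply: cvg_expr; rewrite gtr0_norm ?invr_gt0 ?invf_lt1//; move: q_ge2; lra.
  refine (squeeze_cvgr _ (cvg_cst (0 : R)) up); apply: nearW => k.
  have q1 : 1 <= q ^+ k by rewrite exprn_ege1//; move: q_ge2; lra.
  have q2 : q ^+ k <= q ^+ k.+1 - 1 by rewrite exprS; move: q_ge2 q1; nra.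
  have qk0 : 0 < q ^+ k by lra.
  rewrite mulr_ge0 ?divr_ge0//=; last by lra.
  rewrite -mulrA; apply: ler_wpM2l => //; apply: ler_pM => //; first by rewrite invr_ge0; lra.
    by lra.
  by rewrite lef_pV2 ?posrE//; lra.
have ev1 := cvgn_near_dist FS1 e3.
have ev2 := cvgn_near_dist tail0 e3.
near \oo => k.
have K1 : `|S - \sum_(j < k.+1) limit_mass q j * F j| <= e / 3.
  by rewrite -(big_mkord xpredT (fun j => limit_mass q j * F j)); near: k.
have K2 : M * (2 / (q ^+ k.+1 - 1)) <= e / 3.
  have : `|0 - M * (2 / (q ^+ k.+1 - 1))| <= e / 3 by near: k.
  by rewrite sub0r normrN; apply: le_trans; exact: ler_norm.
have lim1 : \sum_(j < k.+1) p N j * F j @[N --> \oo] --> \sum_(j < k.+1) limit_mass q j * F j.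
  by apply: cvg_big => [|j _]; [exact: add_continuous|apply: cvgMl; exact: mcvg].
have ev3 := cvgn_near_dist lim1 e3.
have ev4 := cvgn_near_dist (p_moment 1%N) ltr01.
near=> N.
have kN : (k <= N)%N by near: N; exact: nbhs_infty_ge.
have N1 : `|\sum_(j < k.+1) limit_mass q j * F j - \sum_(j < k.+1) p N j * F j| <= e / 3 by near: N.
have N2 : \sum_(j < N.+2) p N j * frames q j 1 <= 2.
  have : `|1 - \sum_(j < N.+2) p N j * frames q j 1| <= 1 by near: N.
  by rewrite ler_norml => /andP[? ?]; lra.
have q1 : 0 < q ^+ k.+1 - 1 by rewrite subr_gt0 exprn_egt1//; move: q_ge2; lra.
have split1 (G : nat -> R) : \sum_(j < N.+2) p N j * G j =
    \sum_(j < k.+1) p N j * G j + \sum_(k.+1 <= j < N.+2) p N j * G j.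
  rewrite -!(big_mkord xpredT (fun j => p N j * G j)) (@big_cat_nat _ _ _ k.+1)//=.
  by rewrite !ltnS leqW.
have N3 : `|\sum_(k.+1 <= j < N.+2) p N j * F j| <= e / 3.
  apply: le_trans (ler_norm_sum _ _ _) _.
  have /andP[_ h] := mass_tail kN.
  apply: le_trans (_ : M * \sum_(k.+1 <= j < N.+2) p N j <= _).
    rewrite mulr_sumr; apply: ler_sum => j _; rewrite normrM ger0_norm// mulrC.
    by rewrite ler_wpM2r.
  apply: le_trans K2; rewrite ler_wpM2l//.
  rewrite -(mass_tailE kN).
  by apply: le_trans h _; rewrite ler_wpM2r// invr_ge0 ltW.
rewrite split1; move: K1 N1 N3.
move: (\sum_(j < k.+1) _) (\sum_(j < k.+1) _) (\sum_(k.+1 <= j < _) _) => a b c.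
rewrite !ler_norml => /andP[? ?] /andP[? ?] /andP[? ?].
by apply/andP; split; lra.
Unshelve. all: by end_near. Qed.

End MomentMethod.

(** * The dimension of the fixed space *)

Section FixDim.
Variables (R : realType) (K : finFieldType) (n : nat).
Local Notation q := (#|K|%:R : R).

Definition fix_space (h : {'GL_n.+1[K]}) : 'M[K]_n.+1 := kermx (GLval h - 1%:M).
Definition fix_dim (h : {'GL_n.+1[K]}) : nat := \rank (fix_space h).

Lemma fix_spaceP m (A : 'M[K]_(m, n.+1)) (h : {'GL_n.+1[K]}) :
  (A *m GLval h == A) = (A <= fix_space h)%MS.
Proof. by rewrite /fix_space sub_kermx mulmxBr mulmx1 subr_eq0. Qed.

Lemma fix_dim_lt h : (fix_dim h < n.+2)%N.
Proof. by rewrite ltnS rank_leq_row. Qed.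

Lemma fixed_vectors_dim (h : {'GL_n.+1[K]}) :
  fixed_vectors (h : {'GL_(n.+1)[K]}) = (#|K| ^ fix_dim h)%N.
Proof.
rewrite /fixed_vectors -card_submx -cardsE.
by apply: eq_card => v; rewrite !inE fix_spaceP.
Qed.

Lemma card_fixed_row_free m (h : {'GL_n.+1[K]}) :
  #|[set A : 'M[K]_(m, n.+1) | row_free A && (A *m GLval h == A)]%SET| =
  row_free_count K m (fix_dim h).
Proof.
pose B := row_base (fix_space h).
have Bf : row_free B := row_base_free _.
rewrite /row_free_count -(card_imset _ (row_free_inj Bf)); apply: eq_card => A.
rewrite inE fix_spaceP -(eq_row_base (fix_space h)) -/B.
apply/andP/imsetP => [[fA /submxP[C AE]]|[C + ->]].
  by exists C => //; rewrite inE /row_free -(mxrankMfree C Bf) -AE.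
by rewrite inE /row_free mxrankMfree// => ->; rewrite submxMl.
Qed.

Lemma frames_row_free m d : frames q d m = (row_free_count K m d)%:R.
Proof.
have [dm|md] := ltnP d m.
  by rewrite frames_eq0// row_free_countE natr_prod (bigD1 (Ordinal dm))//= subnn mul0r.
rewrite row_free_countE natr_prod; apply: eq_bigr => a _.
rewrite natrB ?natrX// leq_pexp2l//; first by rewrite (leq_trans _ (card_field_ge2 K)).
exact: leq_trans (ltnW (ltn_ord a)) md.
Qed.

End FixDim.

Section FixMass.
Variables (R : realType) (K : finFieldType) (r : nat) (w : free_group r).
Local Notation q := (#|K|%:R : R).
Local Notation G n := {ffun 'I_r -> {'GL_n.+1[K]}}.

Definition fix_mass (n k : nat) : R :=
  (\sum_(g : G n | fix_dim (word_eval g w) == k) 1) / #|{: G n}|%:R.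

Let cardG_gt0 n : 0 < #|{: G n}|%:R :> R.
Proof. by rewrite ltr0n; apply/card_gt0P; exists [ffun=> 1%g]. Qed.

Lemma fix_mass_ge0 n k : 0 <= fix_mass n k.
Proof. by rewrite divr_ge0 ?sumr_ge0// ltW. Qed.

Lemma fix_mass_out n k : (n.+2 <= k)%N -> fix_mass n k = 0.
Proof.
move=> nk; rewrite /fix_mass big_pred0 ?mul0r// => g.
by rewrite ltn_eqF// (leq_trans (fix_dim_lt _)).
Qed.

(** Group the tuples of matrices by the dimension of the fixed space. *)
Lemma fix_mass_average n (F : nat -> R) :
  \sum_(k < n.+2) fix_mass n k * F k =
  (\sum_(g : G n) F (fix_dim (word_eval g w))) / #|{: G n}|%:R.
Proof.
pose D g : 'I_n.+2 := Ordinal (fix_dim_lt (word_eval (g : G n) w)).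
rewrite (partition_big D xpredT)//= mulr_suml; apply: eq_bigr => k _.
rewrite /fix_mass mulrAC mulr_suml; congr (_ / _).
apply: eq_big => [g|g /eqP->]; last by rewrite mul1r.
by rewrite -val_eqE.
Qed.

Lemma fix_mass_sum n : \sum_(k < n.+2) fix_mass n k = 1.
Proof.
under eq_bigr do rewrite -[fix_mass _ _]mulr1.
by rewrite (fix_mass_average n (fun=> 1)) sumr_const -mulr_natr mul1r divff// gt_eqF.
Qed.

Lemma fix_mass_moment m : w <> 1%g -> nonpower w ->
  (\sum_(k < n.+2) fix_mass n k * frames q k m @[n --> \oo] --> (1 : R))%classic.
Proof.
move=> w1 wn; have h := @nonpower_moment_cvg R K r m w w1 wn.
have <- : (fun n => (\sum_(g : G n) #|fixed_frames m g (val w)|)%:R /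
    #|{: {'GL_n.+1[K]}}|%:R ^+ r) =
  (fun n => \sum_(k < n.+2) fix_mass n k * frames q k m); last exact: h.
apply/funext => n; rewrite (fix_mass_average n (fun k => frames q k m)) natr_sum card_ffun card_ord natrX.
congr (_ / _); apply: eq_bigr => g _.
by rewrite frames_row_free -card_fixed_row_free.
Qed.

End FixMass.

(** * Integrals against atomic and uniform measures *)

Lemma eseries_EFin (R : realType) (u : nat -> R) (l : R) :
  series u @ \oo --> l -> (\sum_(0 <= k <oo) (u k)%:E)%E = l%:E.
Proof.
move=> ul; have -> : l = limn (series u) by rewrite (cvg_lim _ ul).
rewrite -EFin_lim; last by apply/cvg_ex; exists l.
by congr (limn _); apply/funext => n; rewrite /= /series/= sumEFin.
Qed.

Section Atoms.
Context d (T : measurableType d) (R : realType).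
Variables (x : nat -> T) (c : nat -> R).
Hypothesis c_ge0 : forall k, 0 <= c k.

(** The measure with mass [c k] at the point [x k]. *)
Definition atoms : {measure set T -> \bar R} :=
  mseries (fun k => mscale (NngNum (c_ge0 k)) (dirac (x k))) 0.

Lemma atomsE (A : set T) (l : R) :
  series (fun k => c k * (x k \in A)%:R) @ \oo --> l -> atoms A = l%:E.
Proof.
move=> cl; rewrite -(eseries_EFin cl) /atoms/= /mseries.
by apply: eq_eseriesr => k _; rewrite /mscale EFinM -diracE.
Qed.

Lemma ge0_integral_atoms (f : T -> R) : measurable_fun setT f -> (forall t, 0 <= f t) ->
  (\int[atoms]_t (f t)%:E = \sum_(0 <= k <oo) (c k * f (x k))%:E)%E.
Proof.
move=> mf f0; have /measurable_EFinP mEf := mf.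
rewrite ge0_integral_measure_series//=; last by move=> t _; rewrite lee_fin.
apply: eq_eseriesr => k _; rewrite ge0_integral_mscale//=; last by move=> t _; rewrite lee_fin.
by rewrite integral_dirac//= diracT mul1e.
Qed.

Lemma is_cvg_atoms_series (g : T -> R) (M : R) : (forall t, `|g t| <= M) ->
  cvgn (series c) -> cvgn (series (fun k => c k * g (x k))).
Proof.
move=> gM cc; apply: normed_cvg; apply: (@series_le_cvg _ _ (fun k => c k * M)).
- by move=> k; exact: normr_ge0.
- by move=> k; rewrite mulr_ge0// (le_trans _ (gM (x 0%N))).
- by move=> k; rewrite /= normrM ger0_norm// ler_wpM2l.
rewrite (_ : series _ = (fun n => series c n * M)); first exact: is_cvgMl.
by apply/funext => n; rewrite /series/= mulr_suml.
Qed.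

(** The positive and the negative part of the function are integrated separately. *)
Lemma integral_atoms (f : T -> R) (M : R) : measurable_fun setT f ->
  (forall t, `|f t| <= M) -> cvgn (series c) ->
  (\int[atoms]_t (f t)%:E = (limn (series (fun k => c k * f (x k))))%:E)%E.
Proof.
move=> mf fM cc; have cvgF g gM := @is_cvg_atoms_series g M gM cc.
have part (g : T -> R) : (forall t, `|g t| <= M) -> measurable_fun setT g -> (forall t, 0 <= g t) ->
    (\int[atoms]_t (g t)%:E = (limn (series (fun k => c k * g (x k))))%:E)%E.
  by move=> gM mg g0; rewrite ge0_integral_atoms//; apply: eseries_EFin; exact: cvgF.
have M0 : 0 <= M by apply: le_trans (fM (x 0%N)).
pose fp t := Num.max (f t) 0; pose fn t := Num.max (- f t) 0.
have mp : measurable_fun setT fp by apply: measurable_maxr.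
have mn : measurable_fun setT fn by apply: measurable_maxr => //; exact: measurableT_comp.
have pM t : `|fp t| <= M.
  by have := fM t; rewrite /fp ler_norml => /andP[? ?]; rewrite ger0_norm ?le_max ?lexx ?orbT// ge_max M0 andbT.
have nM t : `|fn t| <= M.
  have := fM t; rewrite /fn ler_norml => /andP[? ?]; rewrite ger0_norm ?le_max ?lexx ?orbT// ge_max M0 andbT.
  by rewrite lerNl.
have p0 t : 0 <= fp t by rewrite le_max lexx orbT.
have n0 t : 0 <= fn t by rewrite le_max lexx orbT.
rewrite integralE.
have -> : (\int[atoms]_t ((fun t => (f t)%:E)^\+)%E t = \int[atoms]_t (fp t)%:E)%E.
  by apply: eq_integral => t _; rewrite funeposE EFin_max.
have -> : (\int[atoms]_t ((fun t => (f t)%:E)^\-)%E t = \int[atoms]_t (fn t)%:E)%E.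
  by apply: eq_integral => t _; rewrite funenegE EFin_max EFinN.
rewrite !part// -EFinB; congr (_%:E).
symmetry; apply: cvg_lim => //.
have -> : series (fun k => c k * f (x k)) =
    series (fun k => c k * fp (x k)) \- series (fun k => c k * fn (x k)).
  apply/funext => n; rewrite /series/= -sumrB; apply: eq_bigr => k _.
  rewrite -mulrBr; congr (_ * _); rewrite /fp /fn /Num.max.
  by rewrite oppr_lt0; case: ltgtP => //; lra.
by apply: cvgB; exact: cvgF.
Qed.
End Atoms.

Section Uniform.
Variables (G : finGroupType) (R : realType).

(* The uniform measure as a sequence of atoms: the elements of [G] in order, followed
   by atoms of mass 0. *)
Let pt (k : nat) : discrete_group G := nth 1%g (enum G) k.
Let wt (k : nat) : R := if (k < #|G|)%N then #|G|%:R^-1 else 0.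

Let wt_ge0 k : 0 <= wt k. Proof. by rewrite /wt; case: ifP => // _; rewrite invr_ge0. Qed.

Let wt_series (F : G -> R) :
  series (fun k => wt k * F (pt k)) @ \oo --> (\sum_(g : G) F g) / #|G|%:R.
Proof.
apply: cvg_near_cst; near=> n.
have Gn : (#|G| <= n)%N by near: n; exact: nbhs_infty_ge.
rewrite /series/= (@big_cat_nat _ _ _ #|G|)//= [X in _ + X]big1_seq ?addr0; last first.
  by move=> k; rewrite mem_index_iota => /andP[_ /andP[Gk _]]; rewrite /wt ltnNge Gk mul0r.
rewrite mulr_suml -big_enum/= (big_nth 1%g) -cardE big_nat_cond [RHS]big_nat_cond.
by apply: eq_bigr => k /andP[/andP[_ kG] _]; rewrite /wt kG mulrC.
Unshelve. all: by end_near. Qed.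

Lemma uniform_group_atoms (A : set (discrete_group G)) :
  uniform_group G R A = atoms pt wt_ge0 A.
Proof.
pose B : {set G} := [set g | g \in A]%SET.
have -> : A = [set g | g \in B].
  by apply/seteqP; split=> g; rewrite /= inE; [move=> ?; apply/mem_set|move/set_mem].
rewrite uniform_groupE; symmetry; apply: atomsE.
have -> : #|B|%:R = \sum_(g : G) (g \in [set g : discrete_group G | g \in B])%:R :> R.
  rewrite -sum1_card natr_sum big_mkcond; apply: eq_bigr => g _.
  by rewrite (mem_setE (fun g => g \in B)); case: (g \in B).
exact: (@wt_series (fun g => (g \in [set g : discrete_group G | g \in B])%:R)).
Qed.

Lemma uniform_group_average (A : set (discrete_group G)) :
  uniform_group G R A = ((\sum_(g : G) (g \in A)%:R) / #|G|%:R)%:E.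
Proof. by rewrite uniform_group_atoms; apply/atomsE/(@wt_series (fun g => (g \in A)%:R)). Qed.

Lemma uniform_integral (F : discrete_group G -> R) :
  (\int[uniform_group G R]_g (F g)%:E = ((\sum_(g : G) F g) / #|G|%:R)%:E)%E.
Proof.
rewrite (eq_measure_integral (atoms pt wt_ge0)); last first.
  by move=> A _ _; exact: uniform_group_atoms.
rewrite (@integral_atoms _ _ _ _ _ wt_ge0 F (\sum_(g : G) `|F g|)).
- by congr (_%:E); apply: cvg_lim => //; exact: wt_series.
- by [].
- by move=> g; rewrite (bigD1 (g : G))//= lerDl sumr_ge0.
apply/cvg_ex; exists ((\sum_(g : G) 1) / #|G|%:R).
have -> : wt = (fun k => wt k * 1) by apply/funext => k; rewrite mulr1.
exact: (@wt_series (fun=> 1)).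
Qed.

End Uniform.

(** * Basis elements and the limit law *)

Section BasisElements.
Variables (r : nat) (G : finGroupType).

Lemma word_eval_comp (g : 'I_r -> G) (B : 'I_r -> free_group r) v :
  word_eval g (word_eval B v) = word_eval (fun j => word_eval g (B j)) v.
Proof.
apply: (@word_eval_unique _ _ (fun j => word_eval g (B j)) (word_eval g \o word_eval B)).
  split=> [|u z] /=; first by rewrite !monoid.gmulf1.
  by rewrite !monoid.gmulfM.
by move=> i; rewrite /= word_eval_gen.
Qed.

Lemma eq_word_eval (g h : 'I_r -> G) v : g =1 h -> word_eval g v = word_eval h v.
Proof. by move=> gh; rewrite (funext gh). Qed.

(** The tuple is recovered by evaluating the preimages of the generators under the
automorphism given by the basis. *)
Lemma basis_eval_inj (B : 'I_r -> free_group r) : is_basis B ->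
  injective (fun g : {ffun 'I_r -> G} => [ffun j => word_eval g (B j)]).
Proof.
move=> [C CK KC]; pose back (g : {ffun 'I_r -> G}) : {ffun 'I_r -> G} :=
  [ffun j => word_eval g (C (free_gen j))].
apply: (can_inj (g := back)) => g; apply/ffunP => j; rewrite ffunE.
rewrite (eq_word_eval _ (ffunE _)) -word_eval_comp KC.
by rewrite word_eval_gen.
Qed.

(** Substituting the basis permutes the tuples, so a basis element may be replaced by a
coordinate of the tuple. *)
Lemma basis_average (R : realFieldType) (B : 'I_r -> free_group r) (i : 'I_r) (F : G -> R) :
  is_basis B ->
  (\sum_(g : {ffun 'I_r -> G}) F (word_eval g (B i))) / #|{: {ffun 'I_r -> G}}|%:R =
  (\sum_(h : G) F h) / #|G|%:R.
Proof.
move=> Bb; have G0 : #|G|%:R != 0 :> R by rewrite pnatr_eq0 -lt0n; apply/card_gt0P; exists 1%g.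
have -> : \sum_(g : {ffun 'I_r -> G}) F (word_eval g (B i)) =
    \sum_(g : {ffun 'I_r -> G}) F (g i).
  rewrite [RHS](reindex_inj (basis_eval_inj Bb)).
  by apply: eq_bigr => g _; rewrite ffunE.
have -> : \sum_(g : {ffun 'I_r -> G}) F (g i) =
    \sum_(g : {ffun 'I_r -> G}) \prod_(j < r) (if j == i then F (g j) else 1).
  apply: eq_bigr => g _; rewrite (bigD1 i)//= eqxx big1 ?mulr1// => j ji.
  by rewrite (negbTE ji).
rewrite -(bigA_distr_bigA (fun j h => if j == i then F h else 1)) (bigD1 i)//= eqxx.
rewrite [X in _ * X / _](eq_bigr (fun=> #|G|%:R)); last by move=> j ji; rewrite (negbTE ji) sumr_const.
rewrite prodr_const cardC1 card_ord card_ffun card_ord natrX.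
have -> : r = r.-1.+1 by rewrite prednK// (leq_trans _ (ltn_ord i)).
by rewrite /= exprS; field; rewrite G0 expf_neq0.
Qed.

End BasisElements.

Section Generators.
Variables (r : nat) (i : 'I_r).

Lemma free_gen_basis : is_basis (@free_gen r).
Proof. by exists id => v; rewrite word_eval_free_gen. Qed.

(** Send all the generators to 1 in the integers modulo [k]: a [k]-th power goes to 0. *)
Lemma free_gen_nonpower : nonpower (free_gen i).
Proof.
move=> v k k2 /(congr1 (word_eval (fun=> Zp1 : 'Z_k))).
rewrite word_eval_gen monoid.gmulfXn.
have x1 (x : 'Z_k) : (x ^+ k = 1)%g.
  rewrite Zp_expg; apply: val_inj => /=.
  by rewrite -[X in (_ * X)%N](Zp_cast k2) modnMl.
by rewrite x1 => /(congr1 val).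
Qed.

End Generators.

Section LimitMeasure.
Variables (R : realType) (K : finFieldType).
Local Notation q := (#|K|%:R : R).
Hypothesis mass_ge0 : forall k, 0 <= limit_mass q k.
Hypothesis mass_sum : series (limit_mass q) @ \oo --> (1 : R).

Let pt (k : nat) : measurableTypeR R := q ^+ k.

(** The total mass is 1 already, so normalizing only serves to make the measure a
probability. *)
Definition limit_law : probability (measurableTypeR R) R :=
  mnormalize (atoms pt mass_ge0) (dirac (0 : measurableTypeR R)).

Lemma limit_lawE A : limit_law A = atoms pt mass_ge0 A.
Proof.
have aT : atoms pt mass_ge0 setT = 1%:E.
  apply: atomsE; have -> : (fun k => limit_mass q k * (pt k \in setT)%:R) = limit_mass q.
    by apply/funext => k; rewrite in_setT mulr1.
  exact: mass_sum.
by rewrite /limit_law /= /mnormalize /= aT /= onee_eq0 /= invr1 mule1.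
Qed.

Lemma limit_law_range : limit_law (range (fun k : nat => q ^+ k)) = 1%E.
Proof.
rewrite limit_lawE; apply: atomsE.
have -> : (fun k => limit_mass q k * (pt k \in range (fun k : nat => q ^+ k))%:R) =
    limit_mass q.
  by apply/funext => k; rewrite mem_set ?mulr1//; exists k.
exact: mass_sum.
Qed.

Lemma limit_law1 k : limit_law [set q ^+ k] = (limit_mass q k)%:E.
Proof.
rewrite limit_lawE; apply: atomsE; apply: cvg_near_cst; near=> n.
have kn : (k < n)%N by near: n; exact: nbhs_infty_gt.
have q1 : 1 < q by have := q_ge2 R K; lra.
rewrite /series/= big_mkord (bigD1 (Ordinal kn))//= mem_set// mulr1 big1 ?addr0// => j jk.
rewrite memNset ?mulr0// => /ieexprIn jE; case/negP: jk; apply/eqP/val_inj/jE.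
  by lra.
by rewrite gt_eqF.
Unshelve. all: by end_near. Qed.

Lemma limit_law_integral (f : R -> R) (M : R) : continuous f -> (forall x, `|f x| <= M) ->
  (\int[limit_law]_x (f x)%:E =
   (limn (series (fun k => limit_mass q k * f (q ^+ k))))%:E)%E /\
  cvgn (series (fun k => limit_mass q k * f (q ^+ k))).
Proof.
move=> fc fM.
have mass_cvg : cvgn (series (limit_mass q)) by apply/cvg_ex; exists 1.
split; last exact: (@is_cvg_atoms_series _ (measurableTypeR R) R pt _ mass_ge0 f M).
rewrite (eq_measure_integral (atoms pt mass_ge0)); last by move=> A _ _; exact: limit_lawE.
exact: (@integral_atoms _ (measurableTypeR R) R pt _ mass_ge0 f M (continuous_measurable_fun fc) fM).
Qed.

Lemma word_expectation r (a : free_group r) n (f : R -> R) :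
  ('E_(uniform_group {ffun 'I_r -> {'GL_n.+1[K]}} R)[f \o fix_word R K n.+1 a] =
   (\sum_(k < n.+2) fix_mass R K a n k * f (q ^+ k))%:E)%E.
Proof.
rewrite expectation.unlock (@fix_mass_average R K r a n (fun k => f (q ^+ k))); transitivity
  (\int[uniform_group {ffun 'I_r -> {'GL_n.+1[K]}} R]_g
    (f (q ^+ fix_dim (word_eval (g : {ffun 'I_r -> {'GL_n.+1[K]}}) a)))%:E)%E.
  apply: eq_integral => g _ /=; congr ((f _)%:E).
  by rewrite /fix_word_fun fixed_vectors_dim natrX.
exact: (uniform_integral (fun g : discrete_group {ffun 'I_r -> {'GL_n.+1[K]}} => f (q ^+ fix_dim (word_eval (g : {ffun 'I_r -> {'GL_n.+1[K]}}) a)))).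
Qed.

Lemma word_cvg r (a : free_group r) : a <> 1%g -> nonpower a ->
  cvg_in_distribution (fun N => fix_word R K N a) limit_law.
Proof.
move=> a1 an f fc [M fM]; have [-> fcv] := limit_law_integral fc fM.
rewrite -(cvg_shiftS (fun N => 'E_(uniform_group {ffun 'I_r -> {'GL_N[K]}} R)[f \o fix_word R K N a])%E).
under eq_fun do rewrite word_expectation.
apply: cvg_EFin; first by apply: nearW.
apply: (@average_cvg R q (q_ge2 R K) (fix_mass R K a) _ _ _ _ (fun k => f (q ^+ k)) M) => //.
- exact: fix_mass_ge0.
- exact: fix_mass_out.
- exact: fix_mass_sum.
- by move=> m; exact: fix_mass_moment.
Qed.

End LimitMeasure.

Section BasisLaw.
Variables (R : realType) (r : nat) (B : 'I_r -> free_group r) (i : 'I_r).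
Hypothesis B_basis : is_basis B.

Lemma basis_integral (G : finGroupType) (F : G -> R) :
  (\int[uniform_group {ffun 'I_r -> G} R]_g (F (word_eval (g : {ffun 'I_r -> G}) (B i)))%:E =
   \int[uniform_group G R]_h (F h)%:E)%E.
Proof.
rewrite (uniform_integral (F : discrete_group G -> R)) -(basis_average i F B_basis).
exact: uniform_integral.
Qed.

Lemma basis_law (G : finGroupType) (A : set G) :
  uniform_group {ffun 'I_r -> G} R [set g | A (word_eval (g : {ffun 'I_r -> G}) (B i))] =
  uniform_group G R A.
Proof.
rewrite !uniform_group_average -(basis_average i (fun h => (h \in A)%:R) B_basis).
by congr (_ / _)%:E.
Qed.

Lemma basis_distribution (K : finFieldType) N :
  distribution (uniform_group {ffun 'I_r -> {'GL_N[K]}} R) (fix_word R K N (B i)) =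
  distribution (uniform_group {'GL_N[K]} R) (fix_uniform R K N).
Proof.
apply/funext => U.
(* The two sides differ only by unfolding the group structures. *)
exact_no_check (@basis_law {'GL_N[K]} (fun h => U (fixed_vectors h)%:R)).
Qed.

Lemma basis_expectation (K : finFieldType) N (f : R -> R) :
  ('E_(uniform_group {ffun 'I_r -> {'GL_N[K]}} R)[f \o fix_word R K N (B i)] =
   'E_(uniform_group {'GL_N[K]} R)[f \o fix_uniform R K N])%E.
Proof.
rewrite expectation.unlock.
exact_no_check (@basis_integral {'GL_N[K]} (fun h => f (fixed_vectors h)%:R)).
Qed.

End BasisLaw.

Unset Implicit Arguments.
Set Strict Implicit.
Set Printing Implicit Defensive.

Theorem theorem1p13 (R : realType) (K : finFieldType) (r : nat)
    (w : free_group r) (r_ge1 : (1 <= r)%N) (w_neq1 : w <> 1%g)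
    (w_nonpower : nonpower w) :
  let q : R := #|K|%:R in
  exists nu : probability (measurableTypeR R) R,
    [/\ cvg_in_distribution (fun N => fix_word R K N w) nu,
        forall a : free_group r, basis_element a ->
          cvg_in_distribution (fun N => fix_word R K N a) nu /\
          (forall N : nat,
             distribution (uniform_group {ffun 'I_r -> {'GL_N[K]}} R)
               (fix_word R K N a) =
             distribution (uniform_group {'GL_N[K]} R) (fix_uniform R K N)),
        nu (range (fun k : nat => q ^+ k)) = 1%E
      & forall k : nat,
          nu [set q ^+ k] =
          (limn (fun n : nat => \prod_(1 <= i < n.+1) (1 - q ^- i))
           * (q ^- (k ^ 2)%N / \prod_(1 <= i < k.+1) (1 - q ^- i) ^+ 2))%:E].
Proof.
move=> q; have q2 : 2 <= q := q_ge2 R K.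
have moments m := @fix_mass_moment R K r w m w_neq1 w_nonpower.
have mass_ge0 k : 0 <= limit_mass q k.
  exact: (limit_mass_ge0 q2 (@fix_mass_ge0 R K r w) (@fix_mass_out R K r w) moments).
have mass_sum : series (limit_mass q) @ \oo --> (1 : R).
  exact: (limit_mass_sum q2 (@fix_mass_ge0 R K r w) (@fix_mass_out R K r w)
    (@fix_mass_sum R K r w) moments).
exists (limit_law mass_ge0); split.
- exact: word_cvg.
- move=> a [B [B_basis [i ->]]]; split; last by move=> N; exact: basis_distribution.
  move=> f fc fM.
  have gen_cvg : cvg_in_distribution (fun N => fix_word R K N (free_gen i)) (limit_law mass_ge0).
    by apply: word_cvg => //; exact: free_gen_nonpower.
  suff -> : (fun N => 'E_(uniform_group {ffun 'I_r -> {'GL_N[K]}} R)[f \o fix_word R K N (B i)])%E =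
      (fun N => 'E_(uniform_group {ffun 'I_r -> {'GL_N[K]}} R)[f \o fix_word R K N (free_gen i)])%E.
    exact: gen_cvg.
  apply/funext => N; rewrite (basis_expectation i B_basis).
  by rewrite (basis_expectation i (@free_gen_basis r)).
- exact: limit_law_range.
- by move=> k; exact: limit_law1.
Qed.
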